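(* Consider the exchangeable model with independent latent factors, and the procedure ''ECA with kurtotic factors'' (both described in the context), with output $\widehat O=\widehat O(\theta,\theta')$ on input $\theta,\theta'\in\mathbb{R}^k$ and the exact moments $\mathrm{Pairs}$, $\mathrm{Quadruples}(\cdot,\cdot)$. Then: (1) (No false positives) For all $\theta,\theta'\in\mathbb{R}^k$, the procedure returns a subset of the columns of $O$ in a canonical form; that is, there are signs $s_1,\dots,s_k\in\{-1,1\}$ such that $\widehat O\subseteq\{s_1\sigma_1O_1,\dots,s_k\sigma_kO_k\}$, where $O_i$ is the $i$-th column of $O$. (2) (Exact recovery) Assume $\kappa_i\neq0$ for each $i\in\{1,\dots,k\}$, and let $\theta,\theta'$ be random vectors sampled uniformly and independently over the unit sphere $\mathcal{S}^{k-1}\subset\mathbb{R}^k$. Then, with probability $1$, the procedure returns all columns of $O$ in a canonical form; that is, there are signs $s_i\in\{-1,1\}$ such that $\widehat O=\{s_1\sigma_1O_1,\dots,s_k\sigma_kO_k\}$.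
   Context: Model. $h=(h_1,\dots,h_k)^\top\in\mathbb{R}^k$ is a random vector with mutually independent coordinates; $\sigma_i^2:=\mathbb{E}[(h_i-\mathbb{E}[h_i])^2]>0$ (with $\sigma_i>0$), $\mu_{i,4}:=\mathbb{E}[(h_i-\mathbb{E}[h_i])^4]$, and the excess kurtosis is $\kappa_i:=\mu_{i,4}/\sigma_i^4-3$. The observed vectors $x_1,x_2,x_3,x_4,\dots\in\mathbb{R}^d$, $d\ge k$, are exchangeable, conditionally independent given $h$, and $\mathbb{E}[x_v\mid h]=Oh$ for every $v$, where $O\in\mathbb{R}^{d\times k}$ has full rank $k$. All moments that appear are assumed to exist and be finite. Moments. $\mu:=\mathbb{E}[x_1]$, $\mathrm{Pairs}:=\mathbb{E}[(x_1-\mu)(x_2-\mu)^\top]$, and for $\eta,\eta'\in\mathbb{R}^d$, $$\mathrm{Quadruples}(\eta,\eta'):=\mathbb{E}[(x_1-\mu)(x_2-\mu)^\top\langle\eta,x_3-\mu\rangle\langle\eta',x_4-\mu\rangle]-(\eta^\top\mathrm{Pairs}\,\eta')\mathrm{Pairs}-(\mathrm{Pairs}\,\eta)(\mathrm{Pairs}\,\eta')^\top-(\mathrm{Pairs}\,\eta')(\mathrm{Pairs}\,\eta)^\top.$$ Canonical form. $O$ is in canonical form if $\sigma_i^2=1$ for each $i$; replacing $O$ by $O\,\mathrm{diag}(\sigma_1,\dots,\sigma_k)$ (and rescaling $h$) puts $O$ in canonical form, and canonical $O$ is only specified up to the sign of each column. Pseudo-inverse. For a matrix $A$ with linearly independent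 columns, $A^+=(A^\top A)^{-1}A^\top$. Procedure ''ECA with kurtotic factors'' (input $\theta,\theta'\in\mathbb{R}^k$, $\mathrm{Pairs}$, $\mathrm{Quadruples}(\cdot,\cdot)$): (i) choose any $U\in\mathbb{R}^{d\times k}$ with $\mathrm{Range}(U)=\mathrm{Range}(\mathrm{Pairs})$; (ii) choose any $V\in\mathbb{R}^{k\times k}$ such that $V^\top(U^\top\mathrm{Pairs}\,U)V$ is the $k\times k$ identity, and set $W=UV$; (iii) let $\Lambda$ be the set of (unit-norm) left singular vectors of $W^\top\mathrm{Quadruples}(W\theta,W\theta')W$ whose singular values are unique (of multiplicity one), one vector, determined up to sign, per such singular value; (iv) return $\widehat O=\{(W^+)^\top\lambda:\lambda\in\Lambda\}$. *)

(* Defs.v *)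
From HB Require Import structures.
From mathcomp Require Import all_boot all_order all_algebra all_fingroup.
From mathcomp Require Import all_classical all_reals all_analysis.

Set Implicit Arguments.
Unset Strict Implicit.
Unset Printing Implicit Defensive.

Import Order.TTheory GRing.Theory Num.Theory.

Local Open Scope classical_set_scope.
Local Open Scope ring_scope.

(* The Borel sigma-algebra of the space of m x n real matrices, generated by
   the entries. *)
Definition mx_borel {R : realType} (m n : nat) : set (set 'M[R]_(m, n)) :=
  <<s [set A : set 'M[R]_(m, n) | exists (i : 'I_m) (j : 'I_n) (B : set R),
         measurable B /\ A = [set M : 'M[R]_(m, n) | B (M i j)]] >>.

Definition random_mx d (T : measurableType d) (R : realType) (m n : nat)
    (X : T -> 'M[R]_(m, n)) : Prop :=
  forall i j, measurable_fun setT (fun w => X w i j).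

Definition mx_integrable d (T : measurableType d) (R : realType)
    (P : probability T R) (m n : nat) (X : T -> 'M[R]_(m, n)) : Prop :=
  forall i j, P.-integrable setT (fun w => (X w i j)%:E).

Definition mx_expectation d (T : measurableType d) (R : realType)
    (P : probability T R) (m n : nat) (X : T -> 'M[R]_(m, n)) : 'M[R]_(m, n) :=
  \matrix_(i, j) fine 'E_P[fun w => X w i j].

Definition centered d (T : measurableType d) (R : realType)
    (P : probability T R) (m n : nat) (X : T -> 'M[R]_(m, n)) :
    T -> 'M[R]_(m, n) :=
  fun w => X w - mx_expectation P X.

Definition sigma_of d (T : measurableType d) (R : realType) (m n : nat)
    (X : T -> 'M[R]_(m, n)) : set (set T) :=
  preimage_set_system setT X (@mx_borel R m n).

Definition same_law d (T : measurableType d) (R : realType)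
    (P : probability T R) (m n : nat) (X Y : T -> 'M[R]_(m, n)) : Prop :=
  forall B, mx_borel B -> P (X @^-1` B) = P (Y @^-1` B).

Definition independent_vectors d (T : measurableType d) (R : realType)
    (P : probability T R) (m n : nat) (X : T -> 'cV[R]_m) (Y : T -> 'cV[R]_n) :
    Prop :=
  forall A B, mx_borel A -> mx_borel B ->
    P (X @^-1` A `&` Y @^-1` B) = (P (X @^-1` A) * P (Y @^-1` B))%E.

Definition component (T : Type) (R : realType) (n : nat) (X : T -> 'cV[R]_n) (i : 'I_n) : T -> R :=
  fun w => X w i 0.

Definition mutually_independent_coords d (T : measurableType d) (R : realType)
    (P : probability T R) (n : nat) (X : T -> 'cV[R]_n) : Prop :=
  forall (J : {set 'I_n}) (B : 'I_n -> set R), (forall i, measurable (B i)) ->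
    P (\bigcap_(i in [set i | i \in J]) (component X i @^-1` B i)) =
    (\prod_(i in J) P (component X i @^-1` B i))%E.

(* The uniform distribution on the unit sphere of R^n is the unique probability
   measure on the sphere that is invariant under the orthogonal group. *)
Definition uniform_on_sphere d (T : measurableType d) (R : realType)
    (P : probability T R) (n : nat) (X : T -> 'cV[R]_n) : Prop :=
  [/\ random_mx X,
      P [set w | \sum_(i < n) (X w i 0) ^+ 2 = 1] = 1%E &
      forall M : 'M[R]_n, M^T *m M = 1%:M ->
        same_law P (fun w => M *m X w) X].

(* For a sub-sigma-algebra G, [Y] is a version of E[X | G]. *)
Definition is_cond_exp d (T : measurableType d) (R : realType)
    (P : probability T R) (G : set (set T)) (X Y : T -> R) : Prop :=
  [/\ P.-integrable setT (EFin \o X),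
      P.-integrable setT (EFin \o Y),
      forall B : set R, measurable B -> G (Y @^-1` B) &
      forall A, G A -> (\int[P]_(w in A) (X w)%:E = \int[P]_(w in A) (Y w)%:E)%E].

(* Existence of versions satisfying the product rule is equivalent to the rule
   for all versions, since versions are almost surely equal. *)
Definition conditionally_independent d (T : measurableType d) (R : realType)
    (P : probability T R) (G : set (set T)) (I : Type) (n : nat)
    (X : I -> T -> 'cV[R]_n) : Prop :=
  forall (m : nat) (v : 'I_m -> I), injective v ->
  forall A : 'I_m -> set T, (forall i, sigma_of (X (v i)) (A i)) ->
  exists2 p : 'I_m -> T -> R,
    forall i, is_cond_exp P G (\1_(A i)) (p i) &
    is_cond_exp P G (\1_(\bigcap_(i in [set: 'I_m]) A i))
      (fun w => \prod_(i < m) p i w).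

Definition exchangeable d (T : measurableType d) (R : realType)
    (P : probability T R) (I : Type) (n : nat) (X : I -> T -> 'cV[R]_n) : Prop :=
  forall (m : nat) (v : 'I_m -> I) (s : 'S_m), injective v ->
    same_law P (fun w => \matrix_(a < n, i < m) X (v (s i)) w a 0)
               (fun w => \matrix_(a < n, i < m) X (v i) w a 0).

Definition stddev d (T : measurableType d) (R : realType)
    (P : probability T R) (X : T -> R) : R :=
  Num.sqrt (fine 'V_P[X]).

Definition excess_kurtosis d (T : measurableType d) (R : realType)
    (P : probability T R) (X : T -> R) : R :=
  fine 'E_P[fun w => (X w - fine 'E_P[X]) ^+ 4] / stddev P X ^+ 4 - 3.

(* The views are indexed by an arbitrary type [I], so that both finite families
   and infinite sequences of views are covered. *)
Record factor_model d (T : measurableType d) (R : realType)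
    (P : probability T R) (k n : nat) (I : Type) (O : 'M[R]_(n, k))
    (h : T -> 'cV[R]_k) (x : I -> T -> 'cV[R]_n) : Prop := FactorModel {
  dim_le : (k <= n)%N;
  full_rank : \rank O = k;
  factors_random : random_mx h;
  factors_independent : mutually_independent_coords P h;
  factors_variance : forall i, (0 < 'V_P[component h i])%E;
  views_random : forall v, random_mx (x v);
  views_exchangeable : exchangeable P x;
  views_conditionally_independent :
    conditionally_independent P (sigma_of h) x;
  views_mean : forall v a,
    is_cond_exp P (sigma_of h) (component (x v) a) (fun w => (O *m h w) a 0)
}.

Definition pairs_integrand (T : Type) (R : realType) (n : nat)
    (x1 x2 : T -> 'cV[R]_n) (mu : 'cV[R]_n) : T -> 'M[R]_n :=
  fun w => (x1 w - mu) *m (x2 w - mu)^T.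

Definition pairs d (T : measurableType d) (R : realType)
    (P : probability T R) (n : nat) (x1 x2 : T -> 'cV[R]_n) : 'M[R]_n :=
  mx_expectation P (pairs_integrand x1 x2 (mx_expectation P x1)).

Definition dotv {R : realType} (n : nat) (u v : 'cV[R]_n) : R :=
  \sum_(a < n) u a 0 * v a 0.

Definition quadruples_integrand (T : Type) (R : realType) (n : nat)
    (x1 x2 x3 x4 : T -> 'cV[R]_n) (mu eta eta' : 'cV[R]_n) : T -> 'M[R]_n :=
  fun w => (dotv eta (x3 w - mu) * dotv eta' (x4 w - mu)) *:
           ((x1 w - mu) *m (x2 w - mu)^T).

Definition quadruples d (T : measurableType d) (R : realType)
    (P : probability T R) (n : nat) (x1 x2 x3 x4 : T -> 'cV[R]_n)
    (eta eta' : 'cV[R]_n) : 'M[R]_n :=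
  let mu := mx_expectation P x1 in
  let Prs := pairs P x1 x2 in
  mx_expectation P (quadruples_integrand x1 x2 x3 x4 mu eta eta')
  - dotv eta (Prs *m eta') *: Prs
  - (Prs *m eta) *m (Prs *m eta')^T
  - (Prs *m eta') *m (Prs *m eta)^T.

Record finite_moments d (T : measurableType d) (R : realType)
    (P : probability T R) (k n : nat) (h : T -> 'cV[R]_k)
    (x1 x2 x3 x4 : T -> 'cV[R]_n) : Prop := FiniteMoments {
  finite_factor_mean : mx_integrable P h;
  finite_factor_variance :
    mx_integrable P (fun w => map_mx (fun t : R => t ^+ 2) (centered P h w));
  finite_factor_fourth :
    mx_integrable P (fun w => map_mx (fun t : R => t ^+ 4) (centered P h w));
  finite_mean : mx_integrable P x1;
  finite_pairs :
    mx_integrable P (pairs_integrand x1 x2 (mx_expectation P x1));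
  finite_quadruples : forall eta eta',
    mx_integrable P
      (quadruples_integrand x1 x2 x3 x4 (mx_expectation P x1) eta eta')
}.

Definition pinv {R : realType} (m n : nat) (A : 'M[R]_(m, n)) : 'M[R]_(n, m) :=
  invmx (A^T *m A) *m A^T.

Definition is_svd {R : realType} (n : nat) (A Q : 'M[R]_n) (s : 'rV[R]_n)
    (Z : 'M[R]_n) : Prop :=
  [/\ Q^T *m Q = 1%:M, Z^T *m Z = 1%:M, forall i, 0 <= s 0 i &
      A = Q *m diag_mx s *m Z^T].

(* For singular values of multiplicity one the left singular vector is unique up
   to sign, and the sign is the one picked by the decomposition (Q, s, Z). *)
Definition simple_left_singular_vectors {R : realType} (n : nat) (Q : 'M[R]_n)
    (s : 'rV[R]_n) : set 'cV[R]_n :=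
  [set col i Q | i in [set i | forall j, s 0 j = s 0 i -> j = i]].

(* Ranges are column spaces, hence the transpositions: %MS compares row spaces. *)
Definition eca_choice {R : realType} (n k : nat) (Prs : 'M[R]_n)
    (U : 'M[R]_(n, k)) (V : 'M[R]_k) : Prop :=
  (U^T == Prs^T)%MS /\ V^T *m (U^T *m Prs *m U) *m V = 1%:M.

(* U and V depend on [Prs] only, so they are fixed before (theta, theta') is
   drawn; for V chosen as a function of (theta, theta') exact recovery can fail.
   The relation leaves the choice of the singular value decomposition free. *)
Definition eca_output {R : realType} (n k : nat)
    (Quad : 'cV[R]_n -> 'cV[R]_n -> 'M[R]_n) (U : 'M[R]_(n, k)) (V : 'M[R]_k)
    (theta theta' : 'cV[R]_k) (Ohat : set 'cV[R]_n) : Prop :=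
  let W := U *m V in
  exists Q s Z,
    is_svd (W^T *m Quad (W *m theta) (W *m theta') *m W) Q s Z /\
    Ohat = [set (pinv W)^T *m l | l in simple_left_singular_vectors Q s].

Definition canonical_columns d (T : measurableType d) (R : realType)
    (P : probability T R) (n k : nat) (O : 'M[R]_(n, k)) (h : T -> 'cV[R]_k)
    (sg : 'I_k -> bool) : set 'cV[R]_n :=
  range (fun i => ((-1) ^+ sg i * stddev P (component h i)) *: col i O).

(* Main.v *)
(* The mean of a product of views is computed by replacing, one view at a time,
   a linear form of a view by its conditional expectation given [h]; hence
   [Pairs = N N^T] and [Quadruples eta eta' = N D N^T], where [N] is [O] in
   canonical form and [D] is diagonal with entries
   [kappa_i <eta, N_i> <eta', N_i>] (the Gaussian part of the fourth moments is
   what the correction terms remove).  Whitening makes [M := W^T N] orthogonal,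
   so the whitened quadruples matrix is [M diag(dl) M^T] with
   [dl_i = kappa_i <theta, M_i> <theta', M_i>].  Its left singular vectors with
   simple singular values are columns of [M] up to sign, and [(W^+)^T] maps [M]
   to [N].  All columns are found as soon as the [dl_i^2] are distinct.
   That holds almost surely because a uniform point of the sphere lies on a
   given hyperplane with probability 0: by rotation invariance this probability
   does not depend on the hyperplane, while a nonzero vector is orthogonal to
   fewer than [k] points of the moment curve. *)
Require Import Defs.
From HB Require Import structures.
From mathcomp Require Import all_boot all_order all_algebra all_fingroup.
From mathcomp Require Import all_classical all_reals all_analysis.
From mathcomp Require Import measurable_realfun simple_functions measurable_fun_approximation.
From mathcomp Require Import ring lra zify.
Set Implicit Arguments.
Unset Strict Implicit.
Unset Printing Implicit Defensive.
Import Order.TTheory GRing.Theory Num.Theory.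
Import numFieldNormedType.Exports.
Local Open Scope classical_set_scope.
Local Open Scope ring_scope.
Import HBNNSimple.

(** * Conditional expectation: pulling out measurable factors *)

Section Pullout.
Context {disp : measure_display} {T : measurableType disp} {R : realType}.
Variable P : probability T R.
Implicit Types (X Y Z U : T -> R) (A : set T).

(** Only the full product of the centered views is assumed integrable; nothing is assumed about
    products in which some of the views are already replaced. Hence [pullout] has to derive the
    integrability of the new product from that of the old one. Conditional independence is given on
    events, whereas the exchange of one view needs its conditional expectation given [h] to serve
    also given [h] and the other views; this is a pi-lambda argument on cylinders. The same product
    rule, over the trivial sigma-algebra, computes the moments of the factors. The singular value
    decomposition is arbitrary and the spectrum may be degenerate, so singular vectors are not
    matched with columns of [M] by listing eigenvalues. Instead, the matrix of their inner products
    has rows and columns of unit norm, and a simple singular value forces a row and a column of it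
    to have a single nonzero entry, 1 or -1. *)

Definition integ (X : T -> R) := P.-integrable setT (EFin \o X).

Lemma integ_measurable X : integ X -> measurable_fun setT X.
Proof. by move=> /measurable_int /measurable_EFinP. Qed.

Lemma integ_le X Y : measurable_fun setT X -> (forall w, `|X w| <= `|Y w|) ->
  integ Y -> integ X.
Proof.
move=> mX XY iY; apply: le_integrable iY => //; first exact/measurable_EFinP.
by move=> w _ /=; rewrite lee_fin.
Qed.

Lemma integD X Y : integ X -> integ Y -> integ (fun w => X w + Y w).
Proof. by move=> iX iY; exact: (integrableD measurableT iX iY). Qed.

Lemma integB X Y : integ X -> integ Y -> integ (fun w => X w - Y w).
Proof. by move=> iX iY; exact: (integrableB measurableT iX iY). Qed.

Lemma integZ c X : integ X -> integ (fun w => c * X w).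
Proof. by move=> iX; exact: (integrableZl measurableT c iX). Qed.

Lemma integ_cst c : integ (fun=> c).
Proof. exact: finite_measure_integrable_cst. Qed.

Lemma integ_sum (I : Type) (s : seq I) (F : I -> T -> R) :
  (forall i, integ (F i)) -> integ (fun w => \sum_(i <- s) F i w).
Proof.
move=> iF; rewrite /integ.
have -> : EFin \o (fun w => \sum_(i <- s) F i w) =
    (fun w => \sum_(i <- s) (F i w)%:E)%E.
  by apply/funext => w /=; rewrite sumEFin.
by apply: integrable_sum => // i _; exact: iF.
Qed.

Lemma integ_indic X A : measurable A -> integ X -> integ (fun w => X w * \1_A w).
Proof.
move=> mA iX; apply: (integ_le _ _ iX).
  by apply: measurable_funM; [exact: integ_measurable|exact: measurable_indic].
by move=> w; rewrite normrM indicE ler_piMr//; case: (w \in A); rewrite ?normr1 ?normr0.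
Qed.

Lemma integral_set_indic A X :
  (\int[P]_(w in A) (X w)%:E = \int[P]_w (X w * \1_A w)%:E)%E.
Proof.
rewrite integral_mkcond; apply: eq_integral => w _.
by rewrite patchE indicE; case: (w \in A); rewrite ?mulr1 ?mulr0.
Qed.

Lemma integralEZ c X : integ X ->
  (\int[P]_w (c * X w)%:E = c%:E * \int[P]_w (X w)%:E)%E.
Proof. by move=> iX; under eq_integral do rewrite EFinM; rewrite integralZl. Qed.

Section PO.
Variables (G : set (set T)) (X Y : T -> R).
Hypothesis Gm : G `<=` measurable.
Hypotheses (iX : integ X) (iY : integ Y).
Hypothesis XY : forall A, G A ->
  (\int[P]_(w in A) (X w)%:E = \int[P]_(w in A) (Y w)%:E)%E.

(** Stated on preimages, exactly as the measurability clause of [is_cond_exp], so that it makes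
    sense for any family [G] of events. *)
Definition submeas (Z : T -> R) := forall B : set R, measurable B -> G (Z @^-1` B).

Lemma submeas_measurable Z : submeas Z -> measurable_fun setT Z.
Proof. by move=> GZ _ B mB; rewrite setTI; exact/Gm/GZ. Qed.

Lemma submeas_comp Z (f : R -> R) : measurable_fun setT f -> submeas Z ->
  submeas (f \o Z).
Proof.
move=> mf GZ B mB; rewrite comp_preimage; apply: GZ.
by rewrite -[X in measurable X]setTI; exact: mf.
Qed.

(** [f] lives on the real line and is composed with [Z], so its level sets pull back to events of
    [G], where [XY] applies; there are finitely many of them. *)
Lemma pullout_simple (Z : T -> R) (f : {nnsfun R >-> R}) : submeas Z ->
  (\int[P]_w (X w * f (Z w))%:E = \int[P]_w (Y w * f (Z w))%:E)%E.
Proof.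
move=> GZ.
have dec U : integ U -> (\int[P]_w (U w * f (Z w))%:E =
    \sum_(y <- finmap.enum_fset (fset_set (range f)))
      (y%:E * \int[P]_(w in Z @^-1` (f @^-1` [set y])) (U w)%:E))%E.
  move=> iU.
  have mA y : measurable (Z @^-1` (f @^-1` [set y])).
    exact/Gm/GZ/measurable_sfunP.
  under eq_integral => w _.
    rewrite fimfunE fsbig_finite//= big_distrr/= -sumEFin.
    under eq_bigr do rewrite mulrCA.
    over.
  rewrite integral_sum//; last first.
    by move=> y; exact: (integZ y (integ_indic (mA y) iU)).
  apply: eq_bigr => y _; rewrite integral_set_indic integralEZ//.
  exact: (integ_indic (mA y) iU).
rewrite !dec//; apply: eq_bigr => y _; congr (_ * _)%E; apply: XY.
exact/GZ/measurable_sfunP.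
Qed.

Lemma pullout_ge0 (Z : T -> R) : submeas Z -> (forall w, 0 <= Z w) ->
  integ (fun w => X w * Z w) -> integ (fun w => Y w * Z w) ->
  (\int[P]_w (X w * Z w)%:E = \int[P]_w (Y w * Z w)%:E)%E.
Proof.
move=> GZ Z0 iXZ iYZ; have mZ := submeas_measurable GZ.
(* [|r|] is nonnegative on the whole line and agrees with [r] at the values of [Z]; its simple
   approximations stay below it, so [|U Z|] dominates. *)
have mf : measurable_fun setT (fun r : R => `|r|%:E).
  by apply/measurable_EFinP; exact: normr_measurable.
pose phi := nnsfun_approx measurableT mf.
have dct U : integ U -> integ (fun w => U w * Z w) ->
    (\int[P]_w (U w * phi n (Z w))%:E)%E @[n --> \oo] -->
    (\int[P]_w (U w * Z w)%:E)%E.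
  move=> iU iUZ.
  have [] // := @dominated_convergence _ _ _ P setT measurableT
    (fun n w => (U w * phi n (Z w))%:E) (fun w => (U w * Z w)%:E)
    (fun w => `|U w * Z w|%:E).
  - move=> n; apply/measurable_EFinP/measurable_funM.
      exact: integ_measurable.
    exact: measurableT_comp.
  - exact/measurable_EFinP/integ_measurable.
  - apply/aeW => w _; apply: cvg_EFin; first exact: nearW.
    apply: cvgMr; rewrite -[X in _ --> X]ger0_norm//.
    have -> : phi^~ (Z w) = approx setT (fun r : R => `|r|%:E) ^~ (Z w).
      by apply/funext => n; rewrite /phi nnsfun_approxE.
    by apply: (@cvg_approx _ _ _ setT (fun r : R => `|r|%:E)) => //; rewrite ltry.
  - exact: integrable_norm.
  - apply/aeW => w n _; rewrite /= lee_fin !normrM ler_wpM2l//.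
    rewrite [X in X <= _]ger0_norm// -lee_fin.
    rewrite /phi nnsfun_approxE.
    exact: (@le_approx _ _ _ setT (fun r : R => `|r|%:E) n (Z w)).
have := dct X iX iXZ; under eq_fun do rewrite pullout_simple//.
by move=> /cvg_unique; apply; [exact: ereal_hausdorff|exact: dct].
Qed.

(** Split [Z] into positive and negative parts. Besides integrability, [Y] only has to share the
    integrals of [X] over [G]; it need not be [G]-measurable, a freedom that [cond_exp_cylinder]
    exploits. *)
Lemma pullout0 (Z : T -> R) : submeas Z ->
  integ (fun w => X w * Z w) -> integ (fun w => Y w * Z w) ->
  (\int[P]_w (X w * Z w)%:E = \int[P]_w (Y w * Z w)%:E)%E.
Proof.
move=> GZ iXZ iYZ; have mZ := submeas_measurable GZ.
have mp : measurable_fun setT (fun r : R => Num.max r 0).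
  exact: measurable_funrpos.
have mn : measurable_fun setT (fun r : R => Num.max (- r) 0).
  exact: measurable_funrneg.
have ip U (f : R -> R) : measurable_fun setT f -> (forall r, `|f r| <= `|r|) ->
    integ U -> integ (fun w => U w * Z w) -> integ (fun w => U w * f (Z w)).
  move=> mf f_le iU iUZ; apply: (integ_le _ _ iUZ).
    by apply: measurable_funM; [exact: integ_measurable|exact: measurableT_comp].
  by move=> w; rewrite !normrM ler_wpM2l.
have lep (r : R) : `|Num.max r 0| <= `|r|.
  by rewrite /Num.max; case: ltP => h; rewrite ?normr0.
have len (r : R) : `|Num.max (- r) 0| <= `|r|.
  by rewrite -[leRHS]normrN; exact: lep.
have dec U : integ U -> integ (fun w => U w * Z w) ->
   (\int[P]_w (U w * Z w)%:E = \int[P]_w (U w * Num.max (Z w) 0)%:E -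
     \int[P]_w (U w * Num.max (- Z w) 0)%:E)%E.
  move=> iU iUZ; rewrite -integralB//; last 2 first.
  - exact: (ip U _ mp lep).
  - exact: (ip U _ mn len).
  apply: eq_integral => w _; rewrite -EFinB -mulrBr; congr (_ * _)%:E.
  by rewrite /Num.max oppr_lt0; case: ltgtP => h; rewrite ?h ?oppr0 ?addr0 ?sub0r ?opprK.
rewrite !dec//; congr (_ - _)%E; apply: pullout_ge0.
- exact: (submeas_comp mp).
- by move=> w; rewrite le_max lexx orbT.
- exact: (ip X _ mp lep).
- exact: (ip Y _ mp lep).
- exact: (submeas_comp mn).
- by move=> w; rewrite le_max lexx orbT.
- exact: (ip X _ mn len).
- exact: (ip Y _ mn len).
Qed.
End PO.

Lemma measurable_sg : measurable_fun setT (@Num.sg R).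
Proof.
have -> : @Num.sg R = (fun r => \1_`]0, +oo[ r - \1_`]-oo, 0[ r).
  apply/funext => r; rewrite !indicE !mem_setE !in_itv/= andbT.
  by case: sgrP; rewrite ?subr0 ?sub0r.
by apply: measurable_funB; exact: measurable_indic.
Qed.

Section SubSigmaAlgebra.
Variable G : set (set T).
Hypotheses (sG : sigma_algebra setT G) (Gm : G `<=` measurable).

(** Bridge to the measurable type generated by [G], from which the closure properties are
    inherited. *)
Lemma submeasP Z :
  submeas G Z <-> measurable_fun setT (Z : g_sigma_algebraType G -> R).
Proof.
split=> [GZ _ B mB|mZ B mB]; first by rewrite setTI; apply: sub_sigma_algebra; exact: GZ.
by have := mZ measurableT B mB; rewrite setTI /measurable/= sigma_algebra_id.
Qed.

Lemma submeas_cst c : submeas G (fun=> c : R).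
Proof. by apply/submeasP; exact: measurable_cst. Qed.

Lemma submeasM X Y : submeas G X -> submeas G Y ->
  submeas G (fun w => X w * Y w).
Proof.
move=> /submeasP mX /submeasP mY; apply/submeasP.
exact: (@measurable_funM _ (g_sigma_algebraType G)).
Qed.

Lemma submeas_prod (I : Type) (s : seq I) (Q : pred I) (F : I -> T -> R) :
  (forall i, Q i -> submeas G (F i)) ->
  submeas G (fun w => \prod_(i <- s | Q i) F i w).
Proof.
move=> GF; elim: s => [|i s IH].
  by under eq_fun do rewrite big_nil; exact: submeas_cst.
under eq_fun do rewrite big_cons.
by have [Qi|nQi] := boolP (Q i) => //; apply: submeasM => //; exact: GF.
Qed.

Lemma submeas_indic A : G A -> submeas G (\1_A : T -> R).
Proof.
move=> GA; apply/submeasP.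
apply: (@measurable_indic _ (g_sigma_algebraType G)).
by apply: sub_sigma_algebra.
Qed.

(* Integrability of [Y * Z] comes from testing against the bounded multiplier
   [sg Y * min |Z| n], for which [Y] times the multiplier is [|Y| * min |Z| n]. *)
Lemma pullout X Y Z : integ X -> integ Y -> submeas G Y -> submeas G Z ->
  (forall A, G A ->
    (\int[P]_(w in A) (X w)%:E = \int[P]_(w in A) (Y w)%:E)%E) ->
  integ (fun w => X w * Z w) ->
  integ (fun w => Y w * Z w) /\
  (\int[P]_w (X w * Z w)%:E = \int[P]_w (Y w * Z w)%:E)%E.
Proof.
move=> iX iY GY GZ XY iXZ.
suff iYZ : integ (fun w => Y w * Z w) by split => //; exact: (pullout0 Gm).
have mY := submeas_measurable Gm GY; have mZ := submeas_measurable Gm GZ.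
pose V n w := Num.sg (Y w) * Num.min `|Z w| n%:R.
have GV n : submeas G (V n).
  apply: submeasM.
    by apply: (submeas_comp (f := Num.sg)) GY; exact: measurable_sg.
  apply: (submeas_comp (f := fun r => Num.min `|r| n%:R)) GZ.
  by apply: measurable_minr; [exact: normr_measurable|exact: measurable_cst].
have YV n w : Y w * V n w = `|Y w| * Num.min `|Z w| n%:R.
  by rewrite /V mulrA [Y w * _]mulrC -normrEsg.
have min0 n w : 0 <= Num.min `|Z w| n%:R by rewrite le_min normr_ge0 ler0n.
have mV n := submeas_measurable Gm (GV n).
have V1 n w : `|V n w| <= `|Z w|.
  rewrite /V normrM normr_sg (ger0_norm (min0 _ _)).
  by case: (Y w != 0); rewrite ?mul1r ?mul0r// ge_min lexx.
have iXV n : integ (fun w => X w * V n w).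
  apply: integ_le iXZ; first exact: (measurable_funM (integ_measurable iX) (mV n)).
  by move=> w; rewrite [leLHS]normrM [leRHS]normrM ler_wpM2l.
have iYV n : integ (fun w => Y w * V n w).
  apply: (@integ_le _ (fun w => n%:R * Y w)); last exact: integZ.
    exact: (measurable_funM mY (mV n)).
  move=> w; rewrite YV !normrM normr_id mulrC ler_wpM2r//.
  by rewrite (ger0_norm (min0 _ _)) ge_min ger0_norm// lexx orbT.
apply/integrableP; split; first exact/measurable_EFinP/(measurable_funM mY mZ).
(* The sequence is constant once [n] exceeds [|Z w|]. *)
have lim w : `|(Y w * Z w)%:E|%E = limn (fun n => (Y w * V n w)%:E).
  apply/esym/cvg_lim => //; apply: cvg_near_cst.
  exists (Num.truncn `|Z w|).+1 => // n /= nZ; rewrite YV normrM min_l//.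
  by apply: ltW; apply: lt_le_trans (truncnS_gt _) _; rewrite ler_nat.
under eq_integral do rewrite lim.
rewrite monotone_convergence//; first last.
- move=> w _ m n mn; rewrite !YV lee_fin ler_wpM2l// le_min !ge_min lexx/=.
  by rewrite ler_nat mn orbT.
- by move=> n w _; rewrite lee_fin YV mulr_ge0.
- by move=> n; exact/measurable_EFinP/(measurable_funM mY (mV n)).
(* Each truncated integral is moved from [Y] to [X] by [pullout0], and is there at most the integral
   of [|X Z|], uniformly in [n]. *)
apply: (@le_lt_trans _ _ (\int[P]_w `|(X w * Z w)%:E|)%E); last first.
  by case/integrableP: iXZ.
apply: lime_le.
  apply: ereal_nondecreasing_is_cvgn => m n mn; apply: ge0_le_integral => //.
  - by move=> w _; rewrite lee_fin YV mulr_ge0.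
  - exact/measurable_EFinP/(measurable_funM mY (mV _)).
  - exact/measurable_EFinP/(measurable_funM mY (mV _)).
  - move=> w _; rewrite !YV lee_fin ler_wpM2l// le_min !ge_min lexx/=.
    by rewrite ler_nat mn orbT.
apply: nearW => n; rewrite -(pullout0 Gm iX iY XY)//.
apply: le_integral => //.
- exact: iXV.
- exact: (integrable_abse iXZ).
move=> w _; rewrite lee_fin; apply: le_trans (ler_norm _) _.
by rewrite [leLHS]normrM [leRHS]normrM ler_wpM2l.
Qed.
End SubSigmaAlgebra.
End Pullout.

(** * Products of conditionally independent variables *)

Section CondIndep.
Context {disp : measure_display} {T : measurableType disp} {R : realType}.
Variable P : probability T R.
Implicit Types (X Y Z U : T -> R) (A H : set T).

Lemma integ_le_ae X Y : measurable_fun setT X ->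
  {ae P, forall w, `|X w| <= `|Y w|} -> integ P Y -> integ P X.
Proof.
move=> mX XY iY; have mY := integ_measurable iY.
apply/integrableP; split; first exact/measurable_EFinP.
case/integrableP : (iY) => _; apply: le_lt_trans.
apply: ae_ge0_le_integral => //.
- exact/measurable_EFinP/measurableT_comp.
- exact/measurable_EFinP/measurableT_comp.
- by apply: filterS XY => w h _; rewrite /= lee_fin.
Qed.

Lemma integral_ae X Y : integ P X -> integ P Y -> {ae P, forall w, X w = Y w} ->
  (\int[P]_w (X w)%:E = \int[P]_w (Y w)%:E)%E.
Proof.
move=> iX iY XY; apply: ae_eq_integral => //.
- exact: measurable_int iX.
- exact: measurable_int iY.
- by apply: filterS XY => w -> _.
Qed.

(** * Order and uniqueness of conditional expectations *)

Section Basics.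
Variable G : set (set T).
Hypotheses (sG : sigma_algebra setT G) (Gm : G `<=` measurable).

Lemma submeasB Z U : submeas G Z -> submeas G U ->
  submeas G (fun w => Z w - U w).
Proof.
move=> /(submeasP sG) mZ /(submeasP sG) mU; apply/(submeasP sG).
exact: (@measurable_funB _ (g_sigma_algebraType G)).
Qed.

(** On the event [D > 0], which lies in [G], the integral of [D = Y - Y'] equals that of
    [X - X' <= 0]; so [D * \1_B] vanishes almost everywhere. *)
Lemma cond_exp_le X Y X' Y' : is_cond_exp P G X Y -> is_cond_exp P G X' Y' ->
  (forall w, X w <= X' w) -> {ae P, forall w, Y w <= Y' w}.
Proof.
move=> [iX iY GY eXY] [iX' iY' GY' eXY'] XX'.
pose D w := Y w - Y' w; have GD : submeas G D by exact: submeasB.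
have iD : integ P D by exact: integB.
pose B := D @^-1` `]0, +oo[.
have GB : G B by apply: GD; exact: measurable_itv.
have mB := Gm GB.
have iDB := integ_indic mB iD.
have DB0 w : 0 <= D w * \1_B w.
  rewrite indicE; case: (boolP (w \in B)); rewrite ?mulr0 ?mulr1//.
  by rewrite inE /B /= in_itv/= andbT => /ltW.
have : (\int[P]_w `|(D w * \1_B w)%:E| = 0)%E.
  apply/eqP; rewrite eq_le; apply/andP; split; last exact: integral_ge0.
  under eq_integral do rewrite gee0_abs ?lee_fin//.
  under eq_integral do rewrite mulrBl EFinB.
  rewrite integralB//; [|exact: (integ_indic mB iY)|exact: (integ_indic mB iY')].
  rewrite -!integral_set_indic -eXY// -eXY'//.
  rewrite (integral_set_indic P B X) (integral_set_indic P B X') -integralB//;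
    [|exact: (integ_indic mB iX)|exact: (integ_indic mB iX')].
  rewrite -[leRHS](integral0 P setT); apply: le_integral => //.
  - exact: (integB (integ_indic mB iX) (integ_indic mB iX')).
  - exact: integrable0.
  - by move=> w _; rewrite -EFinB -mulrBl lee_fin mulr_le0_ge0// subr_le0.
move/ae_eq_integral_abs => /(_ measurableT (measurable_int _ iDB)).
apply: filterS => w /(_ I) /= [] /eqP; rewrite mulf_eq0 indicE => DB.
rewrite -subr_le0 leNgt; apply/negP => D0; move: DB.
have wB : w \in B by rewrite inE /B /= in_itv/= andbT.
by rewrite wB /= oner_eq0 orbF => /eqP D00; move: D0; rewrite -/(D w) D00 ltxx.
Qed.

Lemma cond_exp_unique X Y Y' : is_cond_exp P G X Y -> is_cond_exp P G X Y' ->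
  {ae P, forall w, Y w = Y' w}.
Proof.
move=> c1 c2; apply: filterS2 (cond_exp_le c1 c2 _) (cond_exp_le c2 c1 _) => //.
by move=> w h1 h2; apply/le_anti/andP.
Qed.

Lemma cond_exp_cst c : is_cond_exp P G (fun=> c) (fun=> c).
Proof. by split=> //; [exact: integ_cst|exact: integ_cst|exact: submeas_cst]. Qed.

(** Comparison with the constants 0 and 1. The bound keeps products with conditional probabilities
    integrable. *)
Lemma cond_exp_indic01 A Y : measurable A -> is_cond_exp P G \1_A Y ->
  {ae P, forall w, `|Y w| <= 1}.
Proof.
move=> mA cY; apply: filterS2 (cond_exp_le (cond_exp_cst 0) cY _)
  (cond_exp_le cY (cond_exp_cst 1) _).
- by move=> w Y0 Y1; rewrite ger0_norm.
- by move=> w; rewrite indicE ler0n.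
- by move=> w; rewrite indicE lern1 leq_b1.
Qed.
End Basics.

Section ProductRule.
Variables (G : set (set T)) (m : nat) (F : 'I_m -> set (set T)).
Hypotheses (sG : sigma_algebra setT G) (Gm : G `<=` measurable).
Hypotheses (sF : forall i, sigma_algebra setT (F i))
  (Fm : forall i, F i `<=` measurable).
Hypothesis CI : forall A : 'I_m -> set T, (forall i, F i (A i)) ->
  exists2 p : 'I_m -> T -> R,
    forall i, is_cond_exp P G (\1_(A i)) (p i) &
    is_cond_exp P G (\1_(\bigcap_(i in [set: 'I_m]) A i))
      (fun w => \prod_(i < m) p i w).

(* A generating pi-system of the sigma-algebra spanned by [G] and all the [F j]
   with [j != i]. *)
Definition cylinders (i : 'I_m) : set (set T) :=
  [set C | exists (A : 'I_m -> set T) H, [/\ forall j, F j (A j), A i = setT, G H &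
     C = (\bigcap_(j in [set: 'I_m]) A j) `&` H]].

Lemma sigmaT (S : set (set T)) : sigma_algebra setT S -> S setT.
Proof. by move=> [S0 SD _]; rewrite -(setD0 setT); exact: SD. Qed.

Lemma sigmaI (S : set (set T)) A H : sigma_algebra setT S -> S A -> S H ->
  S (A `&` H).
Proof.
move=> sS SA SH; rewrite -(sigma_algebra_id sS).
have mS B : S B -> measurable (B : set (g_sigma_algebraType S)).
  by move=> SB; apply: sub_sigma_algebra.
exact: (measurableI _ _ (mS _ SA) (mS _ SH)).
Qed.

Lemma measurable_bigcapF (A : 'I_m -> set T) : (forall j, F j (A j)) ->
  measurable (\bigcap_(j in [set: 'I_m]) A j).
Proof. by move=> FA; apply: fin_bigcap_measurable => // j _; exact/Fm/FA. Qed.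

(** Let [C] be the intersection of [D] and [H], and [q] the conditional probability of [D]. Three
    exchanges lead from [Y] to [g]: [\1_D] becomes [q] (tested on [F i], with multiplier [Y]), then
    [Y] becomes [g], then [q] becomes [\1_D] again (both tested on [G]). *)
Lemma cond_exp_cylinder i Y g C : submeas (F i) Y -> is_cond_exp P G Y g ->
  cylinders i C ->
  (\int[P]_(w in C) (Y w)%:E = \int[P]_(w in C) (g w)%:E)%E.
Proof.
move=> FY [iY ig Gg eY] [A [H [FA AiT GH ->]]].
set D := \bigcap_(j in _) A j.
have [p ep eq] := CI FA.
pose q w := \prod_(j < m) p j w.
have mD : measurable D by exact: measurable_bigcapF.
have mH := Gm GH.
have Gq : submeas G q by case: eq.
have iq : integ P q by case: eq.
have q1 : {ae P, forall w, `|q w| <= 1} by exact: (cond_exp_indic01 sG Gm mD eq).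
have qle Z : integ P Z -> integ P (fun w => Z w * q w).
  move=> iZ; apply: (integ_le_ae _ _ iZ).
    exact: (measurable_funM (integ_measurable iZ) (integ_measurable iq)).
  by apply: filterS q1 => w h; rewrite normrM ler_piMr.
pose X1 w := \1_D w * \1_H w : R; pose Y1 w := q w * \1_H w.
have i1D : integ P (\1_D : T -> R) by apply: integrable_indic.
have iX1 : integ P X1 by exact: integ_indic.
have iY1 : integ P Y1 by exact: integ_indic.
have GH1 := submeas_indic sG GH : submeas G (\1_H : T -> R).
have GY1 : submeas G Y1 by exact: submeasM.
have swap : (fun w => Y w * Y1 w) = (fun w => Y1 w * Y w).
  by apply/funext => w; rewrite mulrC.
have iYY1 : integ P (fun w => Y w * Y1 w).
  have -> : (fun w => Y w * Y1 w) = (fun w => Y w * q w * \1_H w).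
    by apply/funext => w; rewrite mulrA.
  exact/integ_indic/qle.
(* The conditional probability of [B] and [D] together is that of [B] times [q]: this is [CI] for
   the family with [B] put in place [i]. *)
have step1 B : F i B ->
  (\int[P]_(w in B) (X1 w)%:E = \int[P]_(w in B) (Y1 w)%:E)%E.
  move=> FB; have mB := Fm FB.
  pose A' j := if j == i then B else A j.
  have FA' j : F j (A' j) by rewrite /A'; case: eqP => [->|].
  have [p' ep' eq'] := CI FA'.
  have A'D : \bigcap_(j in [set: 'I_m]) A' j = B `&` D.
    apply/seteqP; split => w.
      move=> A'w; split; first by have := A'w i I; rewrite /A' eqxx.
      move=> j _; have := A'w j I; rewrite /A'.
      by case: eqP => [->|//]; rewrite AiT.
    by move=> [Bw Dw] j _; rewrite /A'; case: eqP => // _; exact: Dw.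
  rewrite !(integral_set_indic _ B).
  have [_ _ _ /(_ _ GH) e1] := eq'.
  transitivity (\int[P]_w ((\prod_(j < m) p' j w) * \1_H w)%:E)%E.
    rewrite -(integral_set_indic P H) -e1 (integral_set_indic P H) A'D; apply: eq_integral => w _.
    by rewrite indicI/= mulrC mulrA.
  have [i1B ip' Gp' eB] : is_cond_exp P G \1_B (p' i).
    by have := ep' i; rewrite /A' eqxx.
  have iBY1 : integ P (fun w => \1_B w * Y1 w).
    by under eq_fun do rewrite mulrC; exact: integ_indic.
  have [ip'Y1 e5] := pullout sG Gm i1B ip' Gp' GY1 eB iBY1.
  under [RHS]eq_integral do rewrite mulrC.
  rewrite e5; apply: integral_ae => //.
    by apply: integ_indic => //; case: eq'.
  (* [CI] returns unrelated versions for [A] and for [A']. They are matched almost surely, and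
     [p i], a version for [setT], is almost surely 1. *)
  have pi1 : {ae P, forall w, p i w = 1}.
    apply: (cond_exp_unique sG Gm (ep i)).
    by rewrite AiT indicT; exact: cond_exp_cst.
  have pp' : {ae P, forall w, forall j, j != i -> p' j w = p j w}.
    apply: filter_forall => j; have [->|ji] := eqVneq j i; first exact: aeW.
    have := ep' j; rewrite /A' (negbTE ji) => ep'j.
    by apply: filterS (cond_exp_unique sG Gm ep'j (ep j)) => w h _.
  apply: filterS2 pi1 pp' => w pi1 pp'.
  rewrite /Y1 /q mulrA; congr (_ * _).
  rewrite (bigD1 i)//= [in RHS](bigD1 i)//= pi1 mul1r.
  by congr (_ * _); apply: eq_bigr.
have iX1Y : integ P (fun w => X1 w * Y w).
  apply: (integ_le _ _ iY).
    exact: (measurable_funM (integ_measurable iX1) (integ_measurable iY)).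
  move=> w; rewrite normrM ler_piMl// /X1 !indicE.
  by case: (_ \in _); case: (_ \in _); rewrite ?mulr0 ?mulr1 ?mul0r ?normr0 ?normr1.
have := pullout0 (Fm (i := i)) iX1 iY1 step1 FY.
move=> /(_ iX1Y); rewrite -swap => /(_ iYY1) e2.
have [igY1 e3] := pullout sG Gm iY ig Gg GY1 eY iYY1.
have [_ _ _ eD] := eq.
have Gg1 : submeas G (fun w => g w * \1_H w) by exact: submeasM.
have iDg : integ P (fun w => \1_D w * (g w * \1_H w)).
  under eq_fun do rewrite mulrC; apply: integ_indic => //; exact: integ_indic.
have [_ e4] := pullout sG Gm i1D iq Gq Gg1 eD iDg.
rewrite !(integral_set_indic _ (D `&` H)).
transitivity (\int[P]_w (X1 w * Y w)%:E)%E.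
  by apply: eq_integral => w _; rewrite indicI mulrC.
rewrite e2; under eq_integral do rewrite mulrC.
rewrite e3; transitivity (\int[P]_w (q w * (g w * \1_H w))%:E)%E.
  by apply: eq_integral => w _; rewrite /Y1 mulrCA.
rewrite -e4; apply: eq_integral => w _.
by rewrite indicI/= mulrCA.
Qed.

Lemma cylinders_setI_closed i : setI_closed (cylinders i).
Proof.
move=> _ _ [A [H [FA Ai GH ->]]] [B [K [FB Bi GK ->]]].
exists (fun j => A j `&` B j), (H `&` K); split.
- by move=> j; exact: sigmaI.
- by rewrite Ai Bi setTI.
- exact: sigmaI.
- by rewrite bigcapI setIACA.
Qed.

Lemma cylinders_measurable i C : cylinders i C -> measurable C.
Proof.
move=> [A [H [FA _ GH ->]]].
by apply: measurableI; [exact: measurable_bigcapF|exact: Gm].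
Qed.

Lemma gen_cylinders_measurable i : <<s cylinders i >> `<=` measurable.
Proof.
apply: smallest_sub; first exact: sigma_algebra_measurable.
exact: cylinders_measurable.
Qed.

Lemma cylindersG i : G `<=` <<s cylinders i >>.
Proof.
move=> H GH; apply: sub_sigma_algebra; exists (fun=> setT), H; split => //.
  by move=> j; exact: sigmaT.
by apply/seteqP; split => [w Hw|w []].
Qed.

Lemma cylindersF i j : j != i -> F j `<=` <<s cylinders i >>.
Proof.
move=> ji B FB; apply: sub_sigma_algebra.
exists (fun l => if l == j then B else setT), setT; split => //.
- by move=> l; case: eqP => [->//|_]; exact: sigmaT.
- by rewrite eq_sym (negbTE ji).
- exact: sigmaT.
- rewrite setIT; apply/seteqP; split => w; last by move=> /(_ j I); rewrite eqxx.
  by move=> Bw l _; case: eqP.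
Qed.

(** Pi-lambda theorem: events with equal integrals are stable under disjoint unions, and under
    complements because the total integrals agree ([setT] lies in [G]). *)
Lemma cond_exp_gen_cylinders i Y g : submeas (F i) Y -> is_cond_exp P G Y g ->
  forall C, <<s cylinders i >> C ->
  (\int[P]_(w in C) (Y w)%:E = \int[P]_(w in C) (g w)%:E)%E.
Proof.
move=> FY cY; have [iY ig Gg eY] := cY.
pose L := [set C | measurable C /\
  (\int[P]_(w in C) (Y w)%:E = \int[P]_(w in C) (g w)%:E)%E].
suff : <<s cylinders i >> `<=` L by move=> CL C /CL[].
apply: lambda_system_subset => //; first exact: cylinders_setI_closed; last first.
  by move=> C cC; split; [exact: cylinders_measurable cC|exact: cond_exp_cylinder cC].
have LT : L setT by split => //; apply: eY; exact: sigmaT.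
have iS (X : T -> R) D : integ P X -> measurable D ->
    P.-integrable D (fun w => (X w)%:E).
  by move=> iX mD; exact: (integrableS measurableT mD (@subsetT _ D) iX).
have iC (X : T -> R) D : integ P X -> measurable D ->
   (\int[P]_(w in ~` D) (X w)%:E =
    \int[P]_w (X w)%:E - \int[P]_(w in D) (X w)%:E)%E.
  move=> iX mD; rewrite (integral_set_indic P (~` D)) (integral_set_indic P D) -integralB//.
    apply: eq_integral => w _; rewrite -EFinB !indicE in_setC.
    by case: (w \in D); rewrite ?mulr1 ?mulr0 ?subr0 ?subrr.
  exact: integ_indic.
apply/dynkin_lambda_system; split => //.
- move=> D [mD eD]; split; first exact: measurableC.
  by rewrite !iC// eD; case: LT => _ ->.
- move=> D tD LD; have mD n : measurable (D n) by case: (LD n).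
  have mU : measurable (\bigcup_n D n) by exact: bigcupT_measurable.
  split => //; rewrite !integral_bigcup//; [|exact: iS..].
  by apply: eq_eseriesr => n _; case: (LD n).
Qed.

(* The [Y i] are replaced by the [g i] one at a time: [g i] is a conditional
   expectation of [Y i] also given [G] and the other [F j], so all the remaining
   factors can be pulled out. *)
Theorem product_rule (Y g : 'I_m -> T -> R) :
  (forall i, submeas (F i) (Y i)) -> (forall i, is_cond_exp P G (Y i) (g i)) ->
  integ P (fun w => \prod_(i < m) Y i w) ->
  integ P (fun w => \prod_(i < m) g i w) /\
  (\int[P]_w (\prod_(i < m) Y i w)%:E = \int[P]_w (\prod_(i < m) g i w)%:E)%E.
Proof.
move=> FY cY iY.
(* Hybrid family: the first [n] factors are already replaced. *)
pose V n (i : 'I_m) w := if (i < n)%N then g i w else Y i w.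
suff VP n : (n <= m)%N -> integ P (fun w => \prod_(i < m) V n i w) /\
    (\int[P]_w (\prod_(i < m) Y i w)%:E = \int[P]_w (\prod_(i < m) V n i w)%:E)%E.
  have [] := VP m (leqnn m).
  have -> // : (fun w => \prod_(i < m) V m i w) = (fun w => \prod_(i < m) g i w).
    by apply/funext => w; apply: eq_bigr => i _; rewrite /V ltn_ord.
  move=> ? e; split => //; rewrite e; apply: eq_integral => w _.
  by congr (_%:E); apply: eq_bigr => i _; rewrite /V ltn_ord.
elim: n => [_|n IH nm].
  have -> // : (fun w => \prod_(i < m) V 0%N i w) = (fun w => \prod_(i < m) Y i w).
    by apply/funext => w; apply: eq_bigr => i _; rewrite /V.
have [iV eV] := IH (ltnW nm).
pose i := Ordinal nm.
pose Z w := \prod_(j < m | j != i) V n j w.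
have sC : sigma_algebra setT (<<s cylinders i >>) by exact: smallest_sigma_algebra.
have CZ : submeas (<<s cylinders i >>) Z.
  apply: submeas_prod => // j ji; rewrite /V; case: (j < n)%N => B mB.
    by apply: cylindersG; have [_ _ Gg _] := cY j; exact: Gg.
  by apply: (cylindersF ji); exact: FY.
have VY w : \prod_(j < m) V n j w = Y i w * Z w.
  by rewrite (bigD1 i)//= /V ltnn.
have Vg w : \prod_(j < m) V n.+1 j w = g i w * Z w.
  rewrite (bigD1 i)//= /V ltnSn; congr (_ * _).
  apply: eq_bigr => j ji; rewrite ltnS leq_eqVlt.
  by rewrite (_ : (j == n :> nat) = false)//; apply/negbTE; move: ji; rewrite -val_eqE.
have [iYi igi Gg _] := cY i.
have Cg : submeas (<<s cylinders i >>) (g i).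
  by move=> B mB; apply: cylindersG; exact: Gg.
rewrite (eq_integral _ _ (fun w _ => congr1 EFin (VY w))) in eV.
rewrite (eq_integral _ _ (fun w _ => congr1 EFin (Vg w))) eV.
move: iV; rewrite (funext VY) (funext Vg).
(* Integrability of the next hybrid product is part of the conclusion of [pullout], which is what
   lets the induction run. *)
apply: (pullout sC _ iYi igi Cg CZ).
  exact: gen_cylinders_measurable.
exact: cond_exp_gen_cylinders.
Qed.
End ProductRule.

End CondIndep.

(** * Moments of independent factors *)

Section Means.
Context {disp : measure_display} {T : measurableType disp} {R : realType}.
Variable P : probability T R.
Implicit Types (X Y Z U : T -> R).

(** Integrability travels with the value, so that linearity composes without side conditions. *)
Definition mean_is X (r : R) := integ P X /\ (\int[P]_w (X w)%:E = r%:E)%E.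

Lemma mean_is_ext X Y r s : (forall w, X w = Y w) -> r = s ->
  mean_is X r -> mean_is Y s.
Proof. by move=> /funext -> ->. Qed.

Lemma mean_is_fine X : integ P X -> mean_is X (fine 'E_P[X]).
Proof.
by move=> iX; split => //; rewrite unlock fineK//; exact: integrable_fin_num.
Qed.

Lemma mean_isE X r : mean_is X r -> fine 'E_P[X] = r.
Proof. by move=> [_ e]; rewrite unlock e. Qed.

Lemma mean_is_cst c : mean_is (fun=> c) c.
Proof.
split; first exact: integ_cst.
by rewrite integral_cst// [X in (_ * X)%E]probability_setT mule1.
Qed.

Lemma mean_isB X Y r s : mean_is X r -> mean_is Y s ->
  mean_is (fun w => X w - Y w) (r - s).
Proof.
move=> [iX eX] [iY eY]; split; first exact: integB.
under eq_integral do rewrite EFinB.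
by rewrite integralB// eX eY.
Qed.

Lemma mean_isZ c X r : mean_is X r -> mean_is (fun w => c * X w) (c * r).
Proof.
move=> [iX eX]; split; first exact: integZ.
by rewrite integralEZ// eX.
Qed.

Lemma mean_is_sum (J : Type) (s : seq J) (F : J -> T -> R) (r : J -> R) :
  (forall i, mean_is (F i) (r i)) ->
  mean_is (fun w => \sum_(i <- s) F i w) (\sum_(i <- s) r i).
Proof.
move=> Fr; split; first by apply: integ_sum => i; case: (Fr i).
under eq_integral do rewrite -sumEFin.
rewrite integral_sum//; last by move=> i; case: (Fr i).
by rewrite -sumEFin; apply: eq_bigr => i _; case: (Fr i).
Qed.

Lemma mean_is_indep_prod k (h : T -> 'cV[R]_k) (f : 'I_k -> R -> R) (r : 'I_k -> R) :
  random_mx h -> mutually_independent_coords P h ->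
  (forall i, measurable_fun setT (f i)) ->
  (forall i, mean_is (fun w => f i (h w i 0)) (r i)) ->
  integ P (fun w => \prod_i f i (h w i 0)) ->
  mean_is (fun w => \prod_i f i (h w i 0)) (\prod_i r i).
Proof.
move=> mh hI mf fr ifp.
(* Independence is conditional independence given the trivial sigma-algebra. *)
pose G : set (set T) := [set A | A = set0 \/ A = setT].
have sG : sigma_algebra setT G.
  split; first by left.
    by move=> A [->|->]; [right; rewrite setD0|left; rewrite setDv].
  move=> A GA; have [[n An]|] := pselect (exists n, A n = setT).
    by right; apply/seteqP; split => // w _; exists n => //; rewrite An.
  move=> /forallNP nA; left; rewrite bigcup0// => n _.
  by case: (GA n) => // /(nA n).
have Gm : G `<=` measurable by move=> A [->|->].
pose F (i : 'I_k) := preimage_set_system setT (component h i) (@measurable _ R).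
have sF i : sigma_algebra setT (F i).
  apply: sigma_algebra_preimage; exact: sigma_algebra_measurable.
have Fm i : F i `<=` measurable by move=> _ [B mB <-]; exact: mh.
have cst X s : mean_is X s -> is_cond_exp P G X (fun=> s).
  move=> [iX eX]; split => //; first exact: integ_cst.
    exact: submeas_cst.
  move=> A [->|->]; first by rewrite !integral_set0.
  by rewrite eX; case: (mean_is_cst s).
have mi A : measurable A -> mean_is (\1_A) (fine (P A)).
  move=> mA; split; first exact: integrable_indic.
  by rewrite integral_indic// setIT fineK// fin_num_measure.
have CI (A : 'I_k -> set T) : (forall i, F i (A i)) ->
    exists2 p : 'I_k -> T -> R,
      forall i, is_cond_exp P G (\1_(A i)) (p i) &
      is_cond_exp P G (\1_(\bigcap_(i in [set: 'I_k]) A i))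
        (fun w => \prod_(i < k) p i w).
  move=> FA; exists (fun i _ => fine (P (A i))).
    by move=> i; apply/cst/mi/Fm/FA.
  apply: cst.
  have [B mB AB] : exists2 B : 'I_k -> set R, forall i, measurable (B i) &
      forall i, A i = component h i @^-1` B i.
    have /choice[B hB] : forall i, exists B : set R,
        measurable B /\ A i = component h i @^-1` B.
      by move=> i; case: (FA i) => B mB <-; exists B; rewrite setTI.
    by exists B => i; case: (hB i).
  have := hI [set: 'I_k]%SET B mB.
  have -> : \bigcap_(i in [set i | i \in [set: 'I_k]%SET]) (component h i @^-1` B i) =
      \bigcap_(i in [set: 'I_k]) A i.
    apply/seteqP; split => w H i _; first by rewrite AB; apply: H; exact: finset.in_setT.
    by rewrite -AB; exact: H.
  move=> PA; have := mi (\bigcap_(i in [set: 'I_k]) A i).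
  rewrite PA (_ : fine _ = \prod_i fine (P (A i))).
    by apply; apply: fin_bigcap_measurable => // i _; exact/Fm/FA.
  rewrite [X in fine X](eq_bigl xpredT); last by move=> i; exact: finset.in_setT.
  rewrite (eq_bigr (fun i => (fine (P (A i)))%:E)).
    by rewrite prodEFin.
  move=> i _; rewrite -AB fineK// fin_num_measure//; exact/Fm/FA.
have FY i : submeas (F i) (fun w => f i (h w i 0)).
  move=> B mB; exists (f i @^-1` B); last by rewrite setTI.
  by rewrite -[X in measurable X]setTI; exact: mf.
have [_ e] := product_rule sG Gm sF Fm CI FY (fun i => cst _ _ (fr i)) ifp.
by split => //; rewrite e; case: (mean_is_cst (\prod_i r i)).
Qed.
End Means.

(** * Fourth-order monomials in independent centered variables *)

Section FourthMoments.
Context {R : comNzRingType} (k : nat).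
Implicit Types (a b c d i : 'I_k).

Lemma prod_expr_delta (X : 'I_k -> R) a : \prod_i X i ^+ (i == a) = X a.
Proof.
rewrite (bigD1 a)//= eqxx expr1 big1 ?mulr1// => i /negbTE ->.
by rewrite expr0.
Qed.

(* The exponent of [X i] in the monomial [X a * X b * X c * X d]. *)
Definition mult4 a b c d i : nat := (i == a) + (i == b) + (i == c) + (i == d).

Lemma prod_expr_mult4 (X : 'I_k -> R) a b c d :
  \prod_i X i ^+ mult4 a b c d i = X a * X b * X c * X d.
Proof.
under eq_bigr do rewrite /mult4 !exprD.
by rewrite !big_split/= !prod_expr_delta.
Qed.

Variables (e : 'I_k -> nat -> R) (v m : 'I_k -> R).
Hypotheses (e0 : forall i, e i 0%N = 1) (e1 : forall i, e i 1%N = 0)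
  (e2 : forall i, e i 2%N = v i) (e4 : forall i, e i 4%N = m i).

(* Wick's formula for the fourth moments of independent centered variables of
   variances [v], plus the diagonal excess [m - 3 v^2]. *)
Definition moment4 a b c d :=
  (a == b)%:R * (c == d)%:R * (v a * v c) + (a == c)%:R * (b == d)%:R * (v a * v b)
  + (a == d)%:R * (b == c)%:R * (v a * v b)
  + ((a == b) && (a == c) && (a == d))%:R * (m a - 3%:R * v a ^+ 2).

Let N a b c d := \prod_i e i (mult4 a b c d i).

Lemma mult4_single a b c d : a != b -> a != c -> a != d -> N a b c d = 0.
Proof.
move=> /negbTE ab /negbTE ac /negbTE ad.
by rewrite /N (bigD1 a)//= /mult4 eqxx ab ac ad e1 mul0r.
Qed.

Lemma mult4_pairs a c : a != c -> N a a c c = v a * v c.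
Proof.
move=> ac; have ca : c != a by rewrite eq_sym.
rewrite /N (bigD1 a)//= (bigD1 c)//= /mult4 !eqxx (negbTE ac) (negbTE ca) !e2.
by rewrite big1 ?mulr1// => i /andP[/negbTE -> /negbTE ->]; rewrite e0.
Qed.

Lemma mult4_all a : N a a a a = m a.
Proof.
rewrite /N (bigD1 a)//= /mult4 !eqxx e4 big1 ?mulr1// => i /negbTE ->.
by rewrite e0.
Qed.

Lemma mult4_ext a b c d a' b' c' d' :
  (forall i, mult4 a b c d i = mult4 a' b' c' d' i) -> N a b c d = N a' b' c' d'.
Proof. by move=> h; apply: eq_bigr => i _; rewrite h. Qed.

(** As [e i 1 = 0], an index occurring once kills the product; three equal indices leave a fourth
    one alone, so third moments never enter. What survives is two pairs, or a fourfold coincidence,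
    where the three pairings give [3 v^2] and the excess corrects this to [m]. [mult4_ext] brings a
    lone index to the front, or equal ones side by side. *)
Lemma prod_mult4 a b c d : \prod_i e i (mult4 a b c d i) = moment4 a b c d.
Proof.
rewrite -/(N a b c d) /moment4.
have ne (x y : 'I_k) : x != y -> ((x == y) = false) * ((y == x) = false).
  by rewrite [y == x]eq_sym => /negbTE.
have [?|ab] := eqVneq a b.
  subst b.
  have [?|cd] := eqVneq c d.
    subst d.
    have [?|ac] := eqVneq a c; first (subst c; rewrite mult4_all ?eqxx//= ?mulr1n; ring).
    rewrite mult4_pairs ?(ne _ _ ac) ?eqxx//=.
    rewrite ?(ne _ _ ac) ?eqxx/= ?mulr1n ?mulr0n; ring.
  have [?|ac] := eqVneq a c.
    subst c.
    rewrite (mult4_ext (a' := d) (b' := a) (c' := a) (d' := a)); last first.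
      by move=> i; rewrite /mult4; lia.
    rewrite mult4_single ?(ne _ _ cd) ?eqxx//=.
    rewrite ?(ne _ _ cd) ?eqxx/= ?mulr1n ?mulr0n; ring.
  rewrite (mult4_ext (a' := c) (b' := a) (c' := a) (d' := d)); last first.
    by move=> i; rewrite /mult4; lia.
  rewrite mult4_single ?(ne _ _ cd) ?(ne _ _ ac) ?eqxx//=.
  rewrite ?(ne _ _ cd) ?(ne _ _ ac) ?eqxx/= ?mulr1n ?mulr0n; ring.
have [?|ac] := eqVneq a c.
  subst c.
  have [?|bd] := eqVneq b d.
    subst d.
    rewrite (mult4_ext (a' := a) (b' := a) (c' := b) (d' := b)); last first.
      by move=> i; rewrite /mult4; lia.
    rewrite mult4_pairs ?(ne _ _ ab) ?eqxx//=.
    rewrite ?(ne _ _ ab) ?eqxx/= ?mulr1n ?mulr0n; ring.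
  rewrite (mult4_ext (a' := b) (b' := a) (c' := a) (d' := d)); last first.
    by move=> i; rewrite /mult4; lia.
  rewrite mult4_single ?(ne _ _ ab) ?(ne _ _ bd) ?eqxx//=.
  rewrite ?(ne _ _ ab) ?(ne _ _ bd) ?eqxx/= ?mulr1n ?mulr0n; ring.
have [?|ad] := eqVneq a d.
  subst d.
  have [?|bc] := eqVneq b c.
    subst c.
    rewrite (mult4_ext (a' := a) (b' := a) (c' := b) (d' := b)); last first.
      by move=> i; rewrite /mult4; lia.
    rewrite mult4_pairs ?(ne _ _ ab) ?(ne _ _ ac) ?eqxx//=.
    rewrite ?(ne _ _ ab) ?(ne _ _ ac) ?eqxx/= ?mulr1n ?mulr0n; ring.
  rewrite (mult4_ext (a' := b) (b' := a) (c' := a) (d' := c)); last first.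
    by move=> i; rewrite /mult4; lia.
  rewrite mult4_single ?(ne _ _ ab) ?(ne _ _ ac) ?(ne _ _ bc) ?eqxx//=.
  rewrite ?(ne _ _ ab) ?(ne _ _ ac) ?(ne _ _ bc) ?eqxx/= ?mulr1n ?mulr0n; ring.
rewrite mult4_single ?(ne _ _ ab) ?(ne _ _ ac) ?(ne _ _ ad) ?eqxx//=.
rewrite ?(ne _ _ ab) ?(ne _ _ ac) ?(ne _ _ ad) ?eqxx/= ?mulr1n ?mulr0n; ring.
Qed.
End FourthMoments.

(** * Second and fourth moments of linear forms *)

Section LinearForms.
Context {disp : measure_display} {T : measurableType disp} {R : realType}.
Variable P : probability T R.
Variables (k : nat) (X : 'I_k -> T -> R) (v m : 'I_k -> R).

Definition linf (al : 'I_k -> R) w := \sum_i al i * X i w.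

(** Domination by the sum of the fourth powers: [|x y| <= x^2 + y^2] is applied to the two half
    products, then to the squares. *)
Lemma integ4 a b c d : (forall i, integ P (fun w => X i w ^+ 4)) ->
  (forall i, measurable_fun setT (X i)) ->
  integ P (fun w => X a w * X b w * X c w * X d w).
Proof.
move=> i4 mX.
apply: (@integ_le _ _ _ _ _
  (fun w => X a w ^+ 4 + X b w ^+ 4 + (X c w ^+ 4 + X d w ^+ 4))).
- by do 3 apply: measurable_funM => //.
- move=> w; have le2 (x y : R) : `|x * y| <= x ^+ 2 + y ^+ 2.
    by rewrite ler_norml; apply/andP; split; nra.
  rewrite -mulrA [leRHS]ger0_norm; last by rewrite !addr_ge0// exprn_even_ge0.
  apply: le_trans (le2 _ _) _; apply: lerD.
    have := le2 (X a w ^+ 2) (X b w ^+ 2); rewrite -!exprM.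
    by apply: le_trans; rewrite exprMn ler_norm.
  have := le2 (X c w ^+ 2) (X d w ^+ 2); rewrite -!exprM.
  by apply: le_trans; rewrite exprMn ler_norm.
- by apply: integD; apply: integD.
Qed.

Hypothesis M2 : forall a b, mean_is P (fun w => X a w * X b w) ((a == b)%:R * v a).
Hypothesis M4 : forall a b c d,
  mean_is P (fun w => X a w * X b w * X c w * X d w) (moment4 v m a b c d).

Lemma sum_delta (a : 'I_k) (F : 'I_k -> R) : \sum_i (a == i)%:R * F i = F a.
Proof.
rewrite (bigD1 a)//= eqxx mul1r big1 ?addr0// => i; rewrite eq_sym => /negbTE ->.
by rewrite mul0r.
Qed.

Lemma mean_linf2 al be :
  mean_is P (fun w => linf al w * linf be w) (\sum_i al i * be i * v i).
Proof.
apply: mean_is_ext (mean_is_sum _ (fun a => mean_is_sum _ (fun b =>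
  mean_isZ (al a * be b) (M2 a b)))).
  move=> w; rewrite /linf big_distrlr/=; apply: eq_bigr => a _.
  by apply: eq_bigr => b _; ring.
apply: eq_bigr => a _; rewrite -[RHS](sum_delta a (fun b => al a * be b * v a)).
by apply: eq_bigr => b _; ring.
Qed.

(** Isserlis' formula with an excess term; the three products of covariances are what [quadruples]
    subtracts. *)
Lemma mean_linf4 al be ga de :
  mean_is P (fun w => linf al w * linf be w * linf ga w * linf de w)
   ((\sum_i al i * be i * v i) * (\sum_i ga i * de i * v i)
    + (\sum_i al i * ga i * v i) * (\sum_i be i * de i * v i)
    + (\sum_i al i * de i * v i) * (\sum_i be i * ga i * v i)
    + \sum_i al i * be i * ga i * de i * (m i - 3%:R * v i ^+ 2)).
Proof.
apply: mean_is_ext (mean_is_sum _ (fun a => mean_is_sum _ (fun b =>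
  mean_is_sum _ (fun c => mean_is_sum _ (fun d =>
  mean_isZ (al a * be b * ga c * de d) (M4 a b c d)))))).
  move=> w; rewrite /linf -!mulrA mulr_suml; apply: eq_bigr => a _.
  rewrite mulr_suml mulr_sumr; apply: eq_bigr => b _.
  rewrite mulr_suml !mulr_sumr; apply: eq_bigr => c _.
  by rewrite !mulr_sumr; apply: eq_bigr => d _; ring.
(* The sums are evaluated from the inside out, each Kronecker delta absorbing the innermost
   index. *)
have s3 a b c : \sum_d al a * be b * ga c * de d * moment4 v m a b c d =
    (b == c)%:R * (al a * be b * ga c * de a * v a * v b)
    + (a == c)%:R * (al a * be b * ga c * de b * v a * v b)
    + (a == c)%:R * (a == b)%:R
        * (al a * be a * ga a * de a * (m a - 3%:R * v a ^+ 2))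
    + (a == b)%:R * (al a * be b * v a) * (ga c * de c * v c).
  transitivity (\sum_d (
     (c == d)%:R * ((a == b)%:R * (al a * be b * v a) * (ga c * de d * v c))
     + (b == d)%:R * ((a == c)%:R * (al a * be b * ga c * de d * v a * v b))
     + (a == d)%:R * ((b == c)%:R * (al a * be b * ga c * de d * v a * v b))
     + (a == d)%:R * ((a == b)%:R * (a == c)%:R
        * (al a * be b * ga c * de d * (m a - 3%:R * v a ^+ 2))))).
    by apply: eq_bigr => d _; rewrite /moment4 -!mulnb !natrM; ring.
  rewrite !big_split/= !sum_delta.
  by have [?|_] := eqVneq a b; have [?|_] := eqVneq a c; try subst b; try subst c;
    rewrite ?eqxx ?mulr1n ?mulr0n; ring.
have s2 a b : \sum_c \sum_d al a * be b * ga c * de d * moment4 v m a b c d =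
    (a == b)%:R * (al a * be b * v a * \sum_c ga c * de c * v c
      + al a * be a * ga a * de a * (m a - 3%:R * v a ^+ 2))
    + al a * ga a * v a * (be b * de b * v b)
    + al a * de a * v a * (be b * ga b * v b).
  under eq_bigr do rewrite s3 -[X in _ + X + _]mulrA.
  rewrite !big_split/= !sum_delta -mulr_sumr; ring.
have s1 a : \sum_b \sum_c \sum_d al a * be b * ga c * de d * moment4 v m a b c d =
    al a * be a * v a * (\sum_c ga c * de c * v c)
    + al a * ga a * v a * (\sum_b be b * de b * v b)
    + al a * de a * v a * (\sum_b be b * ga b * v b)
    + al a * be a * ga a * de a * (m a - 3%:R * v a ^+ 2).
  under eq_bigr do rewrite s2.
  rewrite !big_split/= sum_delta -!mulr_sumr; ring.
under eq_bigr do rewrite s1.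
by rewrite !big_split/= -!mulr_suml.
Qed.
End LinearForms.

(** * The factor model *)

(** Naming the generators of [mx_borel] turns the matrices into a measurable type [mxB], with
    [mx_borel] as its sigma-algebra. *)
Definition mx_gens {R : realType} (m n : nat) : set (set 'M[R]_(m, n)) :=
  [set A : set 'M[R]_(m, n) | exists (i : 'I_m) (j : 'I_n) (B : set R),
         measurable B /\ A = [set M : 'M[R]_(m, n) | B (M i j)]].

Notation mxB R m n := (g_sigma_algebraType (@mx_gens R m n)).

Section MatrixBorel.
Context {R : realType} (m n : nat).

Lemma measurable_entry i j : measurable_fun setT (fun M : mxB R m n => M i j).
Proof.
move=> _ B mB; rewrite setTI; apply: sub_sigma_algebra.
by exists i, j, B.
Qed.

Context {disp : measure_display} {T : measurableType disp}.

Lemma measurable_random_mx (X : T -> 'M[R]_(m, n)) : random_mx X ->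
  measurable_fun setT (X : T -> mxB R m n).
Proof.
move=> mX; apply: (@measurability _ _ T (mxB R m n) setT X (@mx_gens R m n)) => //.
by move=> _ [_ [i [j [B [mB ->]]]] <-]; exact: mX.
Qed.

Lemma sigma_of_measurable (X : T -> 'M[R]_(m, n)) : random_mx X ->
  sigma_of X `<=` measurable.
Proof. by move=> mX _ [B mB <-]; exact: measurable_random_mx. Qed.

Lemma sigma_algebra_sigma_of (X : T -> 'M[R]_(m, n)) :
  sigma_algebra setT (sigma_of X).
Proof. exact/sigma_algebra_preimage/smallest_sigma_algebra. Qed.

Lemma sigma_of_submeas (X : T -> 'M[R]_(m, n)) (f : 'M[R]_(m, n) -> R) :
  measurable_fun setT (f : mxB R m n -> R) -> submeas (sigma_of X) (f \o X).
Proof.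
move=> mf B mB; exists (f @^-1` B); last by rewrite setTI.
by have := mf measurableT B mB; rewrite setTI.
Qed.
End MatrixBorel.

Lemma measurable_dotv {R : realType} n (eta : 'cV[R]_n) :
  measurable_fun setT (fun u : mxB R n 1 => dotv eta u).
Proof.
apply: measurable_sum => i; apply: measurable_funM; first exact: measurable_cst.
exact: measurable_entry.
Qed.

Section CondExpLinear.
Context {disp : measure_display} {T : measurableType disp} {R : realType}.
Variables (P : probability T R) (G : set (set T)).
Hypotheses (sG : sigma_algebra setT G) (Gm : G `<=` measurable).

Lemma cond_exp_affine n (c : 'I_n -> R) (c0 : R) (X Y : 'I_n -> T -> R) :
  (forall a, is_cond_exp P G (X a) (Y a)) ->
  is_cond_exp P G (fun w => \sum_a c a * X a w - c0) (fun w => \sum_a c a * Y a w - c0).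
Proof.
move=> XY.
have iX a : integ P (X a) by case: (XY a).
have iY a : integ P (Y a) by case: (XY a).
have iS (Z : 'I_n -> T -> R) : (forall a, integ P (Z a)) ->
    integ P (fun w => \sum_a c a * Z a w - c0).
  move=> iZ; apply: integB; last exact: integ_cst.
  by apply: integ_sum => a; exact: integZ.
split; [exact: iS|exact: iS| |].
  apply: submeasB => //; last exact: submeas_cst.
  apply/(submeasP sG); apply: (@measurable_sum _ (g_sigma_algebraType G)) => a.
  apply: measurable_funM; first exact: measurable_cst.
  by apply/(submeasP sG); case: (XY a).
move=> A GA; rewrite !(integral_set_indic _ A).
have mA := Gm GA.
have mean Z : integ P Z -> mean_is P (fun w => Z w * \1_A w) (fine (\int[P]_(w in A) (Z w)%:E)).
  move=> iZ; have iZA := integ_indic mA iZ; split => //.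
  by rewrite (integral_set_indic P A) fineK//; exact: (integrable_fin_num measurableT iZA).
pose r a := fine (\int[P]_(w in A) (X a w)%:E).
(* The integral over [A] of the combination depends on the [Z a] only through their integrals [r a],
   which [X] and [Y] share. *)
have H (Z : 'I_n -> T -> R) : (forall a, mean_is P (fun w => Z a w * \1_A w) (r a)) ->
  mean_is P (fun w => (\sum_a c a * Z a w - c0) * \1_A w)
    (\sum_a c a * r a - c0 * fine (\int[P]_(w in A) 1%:E)).
  move=> mZ; apply: mean_is_ext (mean_isB (mean_is_sum _ (fun a => mean_isZ (c a) (mZ a)))
    (mean_isZ c0 (mean (fun=> 1) (integ_cst P 1)))) => // w.
  rewrite mulrBl mulr_suml mul1r; congr (_ - _).
  by apply: eq_bigr => a _; rewrite mulrA.
have [_ ->] := H X (fun a => mean (X a) (iX a)).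
have [|_ -> //] := H Y; move=> a; have := mean (Y a) (iY a).
by rewrite /r; case: (XY a) => _ _ _ ->.
Qed.
End CondExpLinear.

(** * Central moments of the factors *)

Section FactorMoments.
Context {disp : measure_display} {T : measurableType disp} {R : realType}.
Variables (P : probability T R) (k : nat) (h : T -> 'cV[R]_k).
Hypotheses (mh : random_mx h) (hI : mutually_independent_coords P h)
  (hV : forall i, (0 < 'V_P[component h i])%E)
  (h1 : mx_integrable P h)
  (h2 : mx_integrable P (fun w => map_mx (fun t : R => t ^+ 2) (centered P h w)))
  (h4 : mx_integrable P (fun w => map_mx (fun t : R => t ^+ 4) (centered P h w))).

Definition dev i w := h w i 0 - fine 'E_P[component h i].
Definition fvar i := fine 'V_P[component h i].
Definition fourth i := fine 'E_P[fun w => dev i w ^+ 4].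

Lemma integ_factor i : integ P (component h i). Proof. exact: h1. Qed.

Lemma measurable_dev i : measurable_fun setT (dev i).
Proof. by apply: measurable_funB; [exact: mh|exact: measurable_cst]. Qed.

Lemma centeredE w i : centered P h w i 0 = dev i w.
Proof. by rewrite /centered !mxE. Qed.

Lemma integ_dev2 i : integ P (fun w => dev i w ^+ 2).
Proof.
have := h2 i 0; rewrite /integ; congr (_.-integrable _ _).
by apply/funext => w /=; rewrite mxE centeredE.
Qed.

Lemma integ_dev4 i : integ P (fun w => dev i w ^+ 4).
Proof.
have := h4 i 0; rewrite /integ; congr (_.-integrable _ _).
by apply/funext => w /=; rewrite mxE centeredE.
Qed.

(** [|y|^n <= 1 + y^4], according to whether [|y|] is at most 1. *)
Lemma integ_dev_exp i n : (n <= 4)%N -> integ P (fun w => dev i w ^+ n).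
Proof.
move=> n4; apply: (@integ_le _ _ _ _ _ (fun w => 1 + dev i w ^+ 4)).
- exact/measurable_funX/measurable_dev.
- move=> w; set y := dev i w; rewrite [leRHS]ger0_norm; last first.
    by rewrite addr_ge0// exprn_even_ge0.
  rewrite normrX; have [y1|y1] := leP `|y| 1.
    by apply: (@le_trans _ _ 1); [exact: exprn_ile1|rewrite lerDl exprn_even_ge0].
  have -> : y ^+ 4 = `|y| ^+ 4 by rewrite -normrX ger0_norm// exprn_even_ge0.
  by apply: (le_trans (ler_weXn2l (ltW y1) n4)); rewrite lerDr.
- by apply: integD; [exact: integ_cst|exact: integ_dev4].
Qed.

Definition dmom i n := fine 'E_P[fun w => dev i w ^+ n].

Lemma mean_dev_exp i n : (n <= 4)%N -> mean_is P (fun w => dev i w ^+ n) (dmom i n).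
Proof. by move=> n4; apply/mean_is_fine/integ_dev_exp. Qed.

Lemma dmom0 i : dmom i 0 = 1.
Proof. by apply: mean_isE; exact: mean_is_cst. Qed.

Lemma dmom1 i : dmom i 1 = 0.
Proof.
apply: mean_isE; apply: mean_is_ext
  (mean_isB (mean_is_fine (integ_factor i)) (mean_is_cst P (fine 'E_P[component h i]))).
- by move=> w; rewrite expr1.
- by rewrite subrr.
Qed.

Lemma dmom2 i : dmom i 2 = fvar i.
Proof.
by rewrite /dmom /fvar /variance covariance.unlock.
Qed.

(** The variance must be finite as well as positive, since [fine] sends infinity to 0. *)
Lemma fvar_gt0 i : 0 < fvar i.
Proof.
rewrite -lte_fin /fvar fineK//.
have -> : ('V_P[component h i] = 'E_P[(fun w => dev i w ^+ 2)%R])%E.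
  by rewrite /variance covariance.unlock.
by rewrite expectation.unlock; exact: (integrable_fin_num measurableT (integ_dev2 i)).
Qed.

Lemma stddev_gt0 i : 0 < stddev P (component h i).
Proof. by rewrite sqrtr_gt0; exact: fvar_gt0. Qed.

Lemma stddev_sq i : stddev P (component h i) ^+ 2 = fvar i.
Proof. by rewrite sqr_sqrtr//; exact/ltW/fvar_gt0. Qed.

(** Identifies the diagonal excess of [moment4]; the factor [stddev^4] is later absorbed by four
    canonical columns. *)
Lemma kurtosisE i : fourth i - 3%:R * fvar i ^+ 2 =
  excess_kurtosis P (component h i) * stddev P (component h i) ^+ 4.
Proof.
rewrite /excess_kurtosis mulrBl divfK; last by rewrite expf_neq0// gt_eqF// stddev_gt0.
by rewrite -stddev_sq -exprM.
Qed.

Lemma mean_dev_prod (n : 'I_k -> nat) : (forall i, (n i <= 4)%N) ->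
  integ P (fun w => \prod_i dev i w ^+ n i) ->
  mean_is P (fun w => \prod_i dev i w ^+ n i) (\prod_i dmom i (n i)).
Proof.
move=> n4; apply: (mean_is_indep_prod
  (f := fun i r => (r - fine 'E_P[component h i]) ^+ n i) mh hI).
- move=> i; apply: measurable_funX; apply: measurable_funB => //.
- by move=> i; exact: mean_dev_exp.
Qed.

Lemma mean_dev4 a b c d :
  mean_is P (fun w => dev a w * dev b w * dev c w * dev d w) (moment4 fvar fourth a b c d).
Proof.
rewrite -(prod_mult4 (e := dmom) dmom0 dmom1 dmom2 (fun=> erefl)).
apply: mean_is_ext (mean_dev_prod (n := mult4 a b c d) _ _) => //.
- by move=> w; rewrite (prod_expr_mult4 (dev^~ w)).
- by move=> i; rewrite /mult4; do 4 case: eqP => _.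
- under eq_fun do rewrite (prod_expr_mult4 (dev^~ _)).
  by apply: integ4; [exact: integ_dev4|exact: measurable_dev].
Qed.

Lemma mean_dev2 a b :
  mean_is P (fun w => dev a w * dev b w) ((a == b)%:R * fvar a).
Proof.
pose n i := ((i == a) + (i == b))%N.
have E w : \prod_i dev i w ^+ n i = dev a w * dev b w.
  under eq_bigr do rewrite /n exprD.
  by rewrite big_split/= !(prod_expr_delta (dev^~ w)).
apply: mean_is_ext (mean_dev_prod (n := n) _ _) => //.
- rewrite /n (bigD1 a)//= eqxx; have [ab|_] := eqVneq a b; last first.
    by rewrite dmom1 !mul0r.
  rewrite mul1r dmom2 big1 ?mulr1// => i /negbTE ia.
  by rewrite -ab ia dmom0.
- by move=> i; rewrite /n; do 2 case: eqP => _.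
- rewrite (funext E).
  apply: (@integ_le _ _ _ _ _ (fun w => dev a w ^+ 2 + dev b w ^+ 2)).
  + by apply: measurable_funM; exact: measurable_dev.
  + move=> w; rewrite [leRHS]ger0_norm; last by rewrite addr_ge0// sqr_ge0.
    by rewrite ler_norml; apply/andP; split; nra.
  + by apply: integD; exact: integ_dev2.
Qed.
End FactorMoments.

Section Dotv.
Context {R : realType} (n : nat).
Implicit Types u v w : 'cV[R]_n.

Lemma dotvE u v : dotv u v = (u^T *m v) 0 0.
Proof. by rewrite mxE; apply: eq_bigr => a _; rewrite mxE. Qed.

Lemma dotv_delta a u : dotv (delta_mx a 0) u = u a 0.
Proof. by rewrite dotvE trmx_delta -rowE mxE. Qed.

Lemma dotvBr u v w : dotv u (v - w) = dotv u v - dotv u w.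
Proof. by rewrite !dotvE mulmxBr !mxE. Qed.

Lemma dotvC u v : dotv u v = dotv v u.
Proof. by apply: eq_bigr => a _; rewrite mulrC. Qed.
End Dotv.

(** * Pairs and quadruples in canonical form *)

Section Model.
Context {disp : measure_display} {T : measurableType disp} {R : realType}.
Variables (P : probability T R) (k d : nat) (I : eqType).
Variables (O : 'M[R]_(d, k)) (h : T -> 'cV[R]_k) (x : I -> T -> 'cV[R]_d).
Hypothesis model : factor_model P O h x.
Hypothesis h1 : mx_integrable P h.

Let mh : random_mx h := factors_random model.
Let sG := sigma_algebra_sigma_of h.
Let Gm := sigma_of_measurable mh.
Local Notation m0 := (O *m mx_expectation P h).
Local Notation coef eta := (fun i => dotv eta (col i O)).

Lemma mean_view u : mx_expectation P (x u) = m0.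
Proof.
apply/matrixP => a b; rewrite ord1 !mxE.
have [iX iY _ e] := views_mean model u a.
have GT : sigma_of h setT by exact: sigmaT.
apply: mean_isE; split=> //; rewrite (e _ GT).
have [_ <- //] : mean_is P (fun w => (O *m h w) a 0)
    (\sum_j O a j * mx_expectation P h j 0).
apply: mean_is_ext (mean_is_sum (index_enum 'I_k) (fun j => mean_isZ (O a j)
   (mean_is_fine (integ_factor h1 j)))).
  by move=> w; rewrite mxE.
by apply: eq_bigr => j _; rewrite mxE.
Qed.

(** Linear combination of the coordinates in [views_mean], followed by [O h - m0 = O (h - E h)]. *)
Lemma cond_exp_view u eta :
  is_cond_exp P (sigma_of h) (fun w => dotv eta (x u w - m0))
    (linf (dev P h) (coef eta)).
Proof.
have := cond_exp_affine sG Gm (fun a => eta a 0) (dotv eta m0)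
  (fun a => views_mean model u a).
congr (is_cond_exp _ _ _ _); apply/funext => w.
  by rewrite dotvBr.
transitivity (dotv eta (O *m (h w - mx_expectation P h))).
  by rewrite mulmxBr dotvBr.
rewrite dotvE mulmxA mxE; apply: eq_bigr => i _.
rewrite dotvE colE mulmxA -colE [in RHS]mxE; congr (_ * _).
by rewrite !mxE.
Qed.

(** The product rule, with [G] generated by [h] and [F l] by the view [u l]; conditional
    independence concerns distinct views, hence the injectivity. *)
Lemma mean_views n (u : 'I_n -> I) (eta : 'I_n -> 'cV[R]_d) (r : R) :
  injective u ->
  integ P (fun w => \prod_l dotv (eta l) (x (u l) w - m0)) ->
  mean_is P (fun w => \prod_l linf (dev P h) (coef (eta l)) w) r ->
  mean_is P (fun w => \prod_l dotv (eta l) (x (u l) w - m0)) r.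
Proof.
move=> ui iX [_ er]; split=> //; rewrite -er.
have sF l : sigma_algebra setT (sigma_of (x (u l))) by exact: sigma_algebra_sigma_of.
have Fm l : sigma_of (x (u l)) `<=` measurable.
  by apply: sigma_of_measurable; exact: views_random model _.
have FY l : submeas (sigma_of (x (u l))) (fun w => dotv (eta l) (x (u l) w - m0)).
  apply: (@sigma_of_submeas _ _ _ _ _ (x (u l)) (fun y => dotv (eta l) (y - m0))).
  under eq_fun do rewrite dotvBr.
  by apply: measurable_funB; [exact: measurable_dotv|exact: measurable_cst].
by have [_ ->] := product_rule sG Gm sF Fm
  (views_conditionally_independent model ui) FY
  (fun l => cond_exp_view (u l) (eta l)) iX.
Qed.

Hypotheses
  (h2 : mx_integrable P (fun w => map_mx (fun t : R => t ^+ 2) (centered P h w)))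
  (h4 : mx_integrable P (fun w => map_mx (fun t : R => t ^+ 4) (centered P h w))).

Let M2 := mean_dev2 mh (factors_independent model) h1 h2 h4.
Let M4 := mean_dev4 mh (factors_independent model) h1 h4.

(** The canonical form with all signs positive. *)
Definition canonO : 'M[R]_(d, k) :=
  \matrix_(a, i) (O a i * stddev P (component h i)).

Lemma dotv_canon eta i : dotv eta (col i canonO) =
  dotv eta (col i O) * stddev P (component h i).
Proof. by rewrite /dotv mulr_suml; apply: eq_bigr => a _; rewrite !mxE mulrA. Qed.

Let fvarE i : fvar P h i = stddev P (component h i) ^+ 2.
Proof. by rewrite stddev_sq//; exact: factors_variance model. Qed.

Lemma canon_sum eta eta' :
  \sum_i coef eta i * coef eta' i * fvar P h i =
  \sum_i dotv eta (col i canonO) * dotv eta' (col i canonO).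
Proof. by apply: eq_bigr => i _; rewrite !dotv_canon fvarE; ring. Qed.

Lemma pairsE v1 v2 : v1 != v2 ->
  mx_integrable P (pairs_integrand (x v1) (x v2) (mx_expectation P (x v1))) ->
  pairs P (x v1) (x v2) = canonO *m canonO^T.
Proof.
move=> v12 iP; apply/matrixP => a b; rewrite !mxE.
have iab := iP a b.
rewrite mean_view in iab *.
pose u (i : 'I_2) := nth v1 [:: v1; v2] i.
(* Basis vectors turn the entry [(a, b)] into a product of two linear forms of the views. *)
pose eta (i : 'I_2) : 'cV[R]_d := nth 0 [:: delta_mx a 0; delta_mx b 0] i.
have ui : injective u.
  by move=> i j /eqP; rewrite nth_uniq//= ?inE ?v12// => /eqP/val_inj.
have E w : \prod_l dotv (eta l) (x (u l) w - m0) =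
    pairs_integrand (x v1) (x v2) m0 w a b.
  rewrite !big_ord_recl big_ord0 mulr1 /eta /u /= !dotv_delta.
  by rewrite /pairs_integrand !mxE big_ord1 !mxE.
have := mean_views (eta := eta) ui; rewrite (funext E) => /(_ _ iab).
move=> H; apply: mean_isE; apply: H.
apply: mean_is_ext (mean_linf2 M2 (coef (delta_mx a 0)) (coef (delta_mx b 0))).
  by move=> w; rewrite !big_ord_recl big_ord0 mulr1 /eta /=.
rewrite canon_sum; apply: eq_bigr => i _.
by rewrite !dotv_delta !mxE.
Qed.

(** In [mean_linf4] with the forms given by [delta_a], [delta_b], [eta], [eta'], pairing the first
    two and the last two cancels the first correction term, the crossed pairings cancel the other
    two, and the diagonal excess remains. *)
Lemma quadruplesE v1 v2 v3 v4 eta eta' : uniq [:: v1; v2; v3; v4] ->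
  mx_integrable P (pairs_integrand (x v1) (x v2) (mx_expectation P (x v1))) ->
  mx_integrable P (quadruples_integrand (x v1) (x v2) (x v3) (x v4)
    (mx_expectation P (x v1)) eta eta') ->
  quadruples P (x v1) (x v2) (x v3) (x v4) eta eta' =
  canonO *m diag_mx (\row_i (excess_kurtosis P (component h i) *
     dotv eta (col i canonO) * dotv eta' (col i canonO))) *m canonO^T.
Proof.
move=> vu iP iQ; have v12 : v1 != v2.
  by move: vu; rewrite /= !inE => /andP[]; case: (v1 == v2).
rewrite /quadruples (pairsE v12 iP) mean_view in iQ *.
apply/matrixP => a b.
have iab := iQ a b.
pose u (i : 'I_4) := nth v1 [:: v1; v2; v3; v4] i.
pose et (i : 'I_4) : 'cV[R]_d := nth 0 [:: delta_mx a 0; delta_mx b 0; eta; eta'] i.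
have ui : injective u.
  by move=> i j /eqP; rewrite nth_uniq// => /eqP/val_inj.
have E w : \prod_l dotv (et l) (x (u l) w - m0) =
    quadruples_integrand (x v1) (x v2) (x v3) (x v4) m0 eta eta' w a b.
  rewrite !big_ord_recl big_ord0 mulr1 /et /u /= !dotv_delta.
  by rewrite /quadruples_integrand !mxE big_ord1 !mxE; ring.
have := mean_views (eta := et) ui; rewrite (funext E) => /(_ _ iab) H.
have K := mean_linf4 M4 (coef (delta_mx a 0)) (coef (delta_mx b 0)) (coef eta) (coef eta').
have L w : linf (dev P h) (coef (delta_mx a 0)) w * linf (dev P h) (coef (delta_mx b 0)) w *
    linf (dev P h) (coef eta) w * linf (dev P h) (coef eta') w =
    \prod_l linf (dev P h) (coef (et l)) w.
  by rewrite !big_ord_recl big_ord0 mulr1 /et /= !mulrA.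
have Q := mean_isE (H _ (mean_is_ext L erefl K)).
have entry (A B : 'M[R]_d) c (s s' t t' : 'cV[R]_d) :
    (A - c *: B - s *m s'^T - t *m t'^T) a b =
    A a b - c * B a b - s a 0 * s' b 0 - t a 0 * t' b 0.
  by rewrite !mxE !big_ord1 !mxE.
have form (u1 u2 : 'cV[R]_d) : dotv u1 (canonO *m canonO^T *m u2) =
    \sum_i dotv u1 (col i canonO) * dotv u2 (col i canonO).
  rewrite dotvE -mulmxA mulmxA mxE; apply: eq_bigr => i _.
  rewrite [in RHS](dotvC u2) !dotvE; congr (_ * _); rewrite !mxE.
    by apply: eq_bigr => j _; rewrite !mxE.
  by apply: eq_bigr => j _; rewrite !mxE.
rewrite entry [mx_expectation _ _ a b]mxE Q.
have -> : (canonO *m canonO^T) a b =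
    dotv (delta_mx a 0) (canonO *m canonO^T *m delta_mx b 0).
  by rewrite dotv_delta -colE [RHS]mxE.
rewrite -[(_ *m eta) a 0]dotv_delta -[(_ *m eta') a 0]dotv_delta.
rewrite -[(_ *m eta) b 0]dotv_delta -[(_ *m eta') b 0]dotv_delta.
rewrite !form !canon_sum.
have -> : (canonO *m diag_mx (\row_i (excess_kurtosis P (component h i) *
       dotv eta (col i canonO) * dotv eta' (col i canonO))) *m canonO^T) a b =
  \sum_i dotv (delta_mx a 0) (col i O) * dotv (delta_mx b 0) (col i O) *
      dotv eta (col i O) * dotv eta' (col i O) *
      (fourth P h i - 3%:R * fvar P h i ^+ 2).
  rewrite mxE; apply: eq_bigr => i _; rewrite mul_mx_diag !mxE.
  rewrite !dotv_canon !dotv_delta !mxE kurtosisE//; last exact: factors_variance model.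
  by ring.
by ring.
Qed.
End Model.

(** * Whitening and singular vectors *)

Section Whitening.
Context {R : realType} (d k : nat).
Variables (N : 'M[R]_(d, k)) (U : 'M[R]_(d, k)) (V : 'M[R]_k).
Hypothesis UV : eca_choice (N *m N^T) U V.

Let W := U *m V.
Let M := W^T *m N.

Lemma whitened_orthogonal : M *m M^T = 1%:M.
Proof.
have [_ <-] := UV.
by rewrite /M /W !trmx_mul !trmxK !mulmxA.
Qed.

(** The columns of [U] lie in the range of [N N^T], so [W = N B] with [B] square. Then
    [M = B^T N^T N] is invertible, hence so is [B], and [W^T W = M B]. Thus
    [(W^+)^T M = N B (M B)^-1 M = N]. *)
Lemma pinv_whitened : (Defs.pinv W)^T *m M = N.
Proof.
have [/andP[/submxP[C eU] _] _] := UV.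
have [B WE] : exists B, W = N *m B.
  by exists (N^T *m C^T *m V); rewrite /W -[U]trmxK eU !trmx_mul !trmxK !mulmxA.
have ME : M = B^T *m (N^T *m N) by rewrite /M WE trmx_mul mulmxA.
have uM : M \in unitmx by case: (mulmx1_unit whitened_orthogonal).
have [uB uK] : B^T \in unitmx /\ N^T *m N \in unitmx.
  by apply/andP; rewrite -unitmx_mul -ME.
have SE : W^T *m W = B^T *m (N^T *m N) *m B.
  by rewrite [X in _ *m X = _]WE mulmxA -/M ME.
have uS : W^T *m W \in unitmx.
  by rewrite SE !unitmx_mul uB uK -unitmx_tr uB.
rewrite /Defs.pinv trmx_mul trmxK trmx_inv trmx_mul trmxK.
rewrite [X in X *m _ *m _]WE ME -[RHS]mulmx1 -!mulmxA; congr (_ *m _).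
by apply: mulmx1C; rewrite -mulmxA -SE mulVmx.
Qed.
End Whitening.

Lemma orthogonal_row_norm {R : realType} k (C : 'M[R]_k) i :
  C *m C^T = 1%:M -> \sum_j C i j ^+ 2 = 1.
Proof.
move=> /matrixP/(_ i i); rewrite !mxE eqxx mulr1n => <-.
by apply: eq_bigr => j _; rewrite mxE expr2.
Qed.

(** * Left singular vectors with simple singular value *)

Section SingularVectors.
Context {R : realType} (k : nat).
Variables (M : 'M[R]_k) (dl : 'rV[R]_k) (Q Z : 'M[R]_k) (s : 'rV[R]_k).
Hypotheses (MM : M *m M^T = 1%:M) (svd : is_svd (M *m diag_mx dl *m M^T) Q s Z).

(** Column [j] holds the coordinates of the [j]-th left singular vector in the orthonormal basis of
    columns of [M]. *)
Let C := M^T *m Q.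

Let QQ : Q^T *m Q = 1%:M. Proof. by case: svd. Qed.

Lemma coords_row i : \sum_j C i j ^+ 2 = 1.
Proof.
apply: orthogonal_row_norm.
by rewrite /C trmx_mul trmxK mulmxA -(mulmxA M^T) (mulmx1C QQ) mulmx1 (mulmx1C MM).
Qed.

Lemma coords_col j : \sum_i C i j ^+ 2 = 1.
Proof.
have : C^T *m C^T^T = 1%:M.
  by rewrite /C trmxK trmx_mul trmxK mulmxA -(mulmxA Q^T) MM mulmx1.
move/(orthogonal_row_norm j) => <-.
by apply: eq_bigr => i _; rewrite [C^T _ _]mxE.
Qed.

(* [A A^T] is diagonalized both by the columns of [M], with eigenvalues
   [dl_i^2], and by those of [Q], with eigenvalues [s_j^2]. *)
Lemma coords_eq i j : C i j != 0 -> dl 0 i ^+ 2 = s 0 j ^+ 2.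
Proof.
have [_ ZZ _ eA] := svd.
have MM' := mulmx1C MM.
have : diag_mx dl *m (diag_mx dl *m C) = C *m diag_mx s *m diag_mx s.
  have E1 : M *m diag_mx dl *m M^T *m (M *m diag_mx dl *m M^T)^T =
      M *m (diag_mx dl *m diag_mx dl) *m M^T.
    rewrite !trmx_mul trmxK tr_diag_mx !mulmxA.
    by rewrite -(mulmxA (M *m diag_mx dl)) MM' mulmx1.
  have E2 : M *m diag_mx dl *m M^T *m (M *m diag_mx dl *m M^T)^T =
      Q *m (diag_mx s *m diag_mx s) *m Q^T.
    rewrite eA !trmx_mul trmxK tr_diag_mx !mulmxA.
    by rewrite -(mulmxA (Q *m diag_mx s)) ZZ mulmx1.
  have : M^T *m (M *m (diag_mx dl *m diag_mx dl) *m M^T) *m Q =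
         M^T *m (Q *m (diag_mx s *m diag_mx s) *m Q^T) *m Q.
    by rewrite -E1 E2.
  by rewrite !mulmxA MM' mul1mx -!mulmxA QQ mulmx1 !mulmxA.
move=> /matrixP/(_ i j); rewrite !mul_diag_mx !mul_mx_diag !mxE.
rewrite mulrA -mulrA mulrC -mulrA => E C0; apply: (mulfI C0).
by rewrite !expr2 -E mulrCA mulrA.
Qed.

Definition simple_value j := forall j', s 0 j' = s 0 j -> j' = j.

Lemma sum_sq_unique (F : 'I_k -> R) a : \sum_i F i ^+ 2 = 1 ->
  (forall i, F i != 0 -> i = a) -> F a ^+ 2 = 1.
Proof.
move=> <- Fa; rewrite (bigD1 a)//= big1 ?addr0// => i ia.
by have [->|/Fa ia'] := eqVneq (F i) 0; [rewrite expr0n|rewrite ia' eqxx in ia].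
Qed.

Lemma sum_sq_others (F : 'I_k -> R) a : \sum_i F i ^+ 2 = 1 -> F a ^+ 2 = 1 ->
  forall i, F i != 0 -> i = a.
Proof.
move=> F1 Fa i Fi; apply/eqP; apply: contraNT Fi => ia.
move: F1; rewrite (bigD1 a)//= Fa -[RHS]addr0 => /addrI/eqP.
rewrite psumr_eq0 => [/allP/(_ i (mem_index_enum _))|j _]; last exact: sqr_ge0.
by rewrite ia/= sqrf_eq0.
Qed.

Lemma sum_sq_exists (F : 'I_k -> R) : \sum_i F i ^+ 2 = 1 -> exists i, F i != 0.
Proof.
move=> F1; apply/existsP; rewrite -[X in is_true X]negbK; apply/negP => /existsPn F0.
move: F1; rewrite big1; first by move/esym/eqP; rewrite oner_eq0.
by move=> i _; have := F0 i; rewrite negbK => /eqP ->; rewrite expr0n.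
Qed.

Lemma singular_value_inj j j' : s 0 j ^+ 2 = s 0 j' ^+ 2 -> s 0 j = s 0 j'.
Proof.
have [_ _ s0 _] := svd; move=> /eqP.
by rewrite eqrXn2// => /eqP.
Qed.

(** By [coords_eq], two nonzero entries of row [i] carry the same squared singular value, hence the
    same singular value. *)
Lemma simple_row i j : simple_value j -> C i j != 0 ->
  forall j', C i j' != 0 -> j' = j.
Proof.
move=> sj Cij j' Cij'; apply: sj; apply: singular_value_inj.
by rewrite -(coords_eq Cij) -(coords_eq Cij').
Qed.

Lemma simple_coord i j : simple_value j -> C i j != 0 -> C i j ^+ 2 = 1.
Proof.
move=> sj Cij; apply: (sum_sq_unique (coords_row i)).
exact: simple_row.
Qed.

(** Row [i] of [C] is concentrated at [j], so [C i j] is 1 or -1; this exhausts the unit norm of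
    column [j], whose other entries vanish. *)
Lemma simple_col i j : simple_value j -> C i j != 0 -> col j Q = C i j *: col i M.
Proof.
move=> sj Cij.
have oth := sum_sq_others (coords_col j) (simple_coord sj Cij).
have -> : Q = M *m C by rewrite /C mulmxA MM mul1mx.
apply/matrixP => a b; rewrite [LHS]mxE [LHS]mxE [RHS]mxE [col i M a b]mxE.
rewrite (bigD1 i)//= big1 ?addr0 1?mulrC//.
move=> l li; have [->|/oth] := eqVneq (C l j) 0; first by rewrite mulr0.
by move=> e; rewrite e eqxx in li.
Qed.

(** At most one simple [j] meets row [i], so the sign is unambiguous; where none does, it defaults
    to +1. *)
Definition column_sign i : bool := `[< exists2 j, simple_value j & C i j = -1 >].

Lemma column_signP i j : simple_value j -> C i j != 0 -> C i j = (-1) ^+ column_sign i.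
Proof.
move=> sj Cij; have /eqP := simple_coord sj Cij.
rewrite sqrf_eq1 => /orP[/eqP Cij1|/eqP Cij1]; last first.
  by rewrite Cij1 /column_sign asboolT//; exists j.
rewrite Cij1 /column_sign asboolF// => -[j' sj' Cij'].
have j'j : j' = j by apply: (simple_row sj Cij); rewrite Cij' oppr_eq0 oner_eq0.
by move: Cij'; rewrite j'j Cij1 => /eqP; rewrite -addr_eq0 -mulr2n pnatr_eq0.
Qed.

Lemma simple_vectors_sub :
  simple_left_singular_vectors Q s `<=`
    range (fun i => (-1) ^+ column_sign i *: col i M).
Proof.
move=> _ [j sj <-]; have [i Cij] := sum_sq_exists (coords_col j).
by exists i => //; rewrite (simple_col sj Cij) (column_signP sj Cij).
Qed.

(** Let [C i j] be nonzero. As the [dl_i^2] are distinct, every column sharing the singular value of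
    [j] is supported at row [i], with entry 1 or -1. Row [i] has unit norm, so there is only one
    such column and [j] is simple. *)
Lemma simple_vectors_eq : (forall i i', dl 0 i ^+ 2 = dl 0 i' ^+ 2 -> i = i') ->
  simple_left_singular_vectors Q s =
    range (fun i => (-1) ^+ column_sign i *: col i M).
Proof.
move=> dl_inj; apply/seteqP; split; first exact: simple_vectors_sub.
move=> _ [i _ <-]; have [j Cij] := sum_sq_exists (coords_row i).
have only j' i' : s 0 j' = s 0 j -> C i' j' != 0 -> i' = i.
  by move=> ss Cij'; apply: dl_inj; rewrite (coords_eq Cij') (coords_eq Cij) ss.
have sq j' : s 0 j' = s 0 j -> C i j' ^+ 2 = 1.
  by move=> ss; apply: (sum_sq_unique (coords_col j')) => i'; exact: only.
have sj : simple_value j.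
  move=> j' ss; apply: (sum_sq_others (coords_row i) (sq j erefl)).
  by rewrite -sqrf_eq0 sq// oner_eq0.
by exists j => //; rewrite (simple_col sj Cij) (column_signP sj Cij).
Qed.
End SingularVectors.

(** * The uniform distribution on the sphere *)

Section Householder.
Context {R : realType} (n : nat).
Implicit Types u v w : 'cV[R]_n.

Lemma dotv_gt0 u : u != 0 -> 0 < dotv u u.
Proof.
move=> u0; rewrite lt_neqAle eq_sym; apply/andP; split; last first.
  by apply: sumr_ge0 => i _; rewrite -expr2 sqr_ge0.
apply: contra u0; rewrite /dotv psumr_eq0 => [/allP u0|i _]; last first.
  by rewrite -expr2 sqr_ge0.
apply/eqP/matrixP => i j; rewrite ord1 mxE.
by have := u0 i (mem_index_enum _); rewrite /= -expr2 sqrf_eq0 => /eqP.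
Qed.

Lemma trmx_mulcV u v : u^T *m v = (dotv u v)%:M.
Proof. by apply/matrixP => i j; rewrite !ord1 dotvE [in RHS]mxE eqxx. Qed.

(** Householder reflection along [w = u - v]: symmetric, and for vectors of equal length it carries
    [v] to [u]. The case [u = v] is apart because [w] would vanish. *)
Lemma reflection_exists u v : dotv u u = dotv v v ->
  exists2 H : 'M[R]_n, H^T *m H = 1%:M & forall y, dotv v (H *m y) = dotv u y.
Proof.
move=> uv; have [->|/eqP uDv] := eqVneq u v.
  by exists 1%:M => [|y]; rewrite ?trmx1 ?mulmx1 ?mul1mx.
pose w := u - v; pose q := dotv w w.
have q0 : q != 0 by rewrite gt_eqF// dotv_gt0// subr_eq0; apply/eqP.
pose B := w *m w^T; pose H := 1%:M - (2 / q) *: B.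
have HT : H^T = H by rewrite /H /B linearB/= trmx1 linearZ/= trmx_mul trmxK.
have HH : H *m H = 1%:M.
  have BB : B *m B = q *: B.
    by rewrite /B mulmxA -(mulmxA w) trmx_mulcV mul_mx_scalar scalemxAl.
  rewrite /H mulmxBl mul1mx mulmxBr mulmx1 -scalemxAl -scalemxAr BB !scalerA.
  have -> : 2 / q * (2 / q) * q = 2 / q + 2 / q by field.
  by rewrite scalerDl opprB addrK subrK.
have Hv : H *m v = u.
  rewrite /H /B mulmxBl mul1mx -scalemxAl -mulmxA trmx_mulcV mul_mx_scalar scalerA.
  (* This is where the equality of lengths enters. *)
  have -> : dotv w v = - (q / 2).
    by rewrite /q /w !dotvBr ![dotv (u - v) _]dotvC !dotvBr uv (dotvC v u); field.
  have -> : 2 / q * - (q / 2) = -1 by field.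
  by rewrite scaleN1r opprK /w addrC subrK.
exists H; first by rewrite HT.
by move=> y; rewrite !dotvE mulmxA -{1}HT -trmx_mul Hv.
Qed.
End Householder.

Section Sphere.
Context {disp : measure_display} {S : measurableType disp} {R : realType}.
Variables (P : probability S R) (n : nat) (X : S -> 'cV[R]_n).
Hypothesis uX : uniform_on_sphere P X.

Let mX : random_mx X. Proof. by case: uX. Qed.

Lemma measurable_dotv_random u : measurable_fun setT (fun w => dotv u (X w)).
Proof.
exact: (measurableT_comp (measurable_dotv u) (measurable_random_mx mX)).
Qed.

Lemma measurable_hyperplane u : measurable [set w | dotv u (X w) = 0].
Proof.
rewrite -[X in measurable X]setTI.
exact: (measurable_dotv_random u measurableT (measurable_set1 0)).
Qed.

Lemma hyperplane_borel (u : 'cV[R]_n) : mx_borel [set y : 'cV[R]_n | dotv u y = 0].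
Proof.
by have := measurable_dotv u measurableT (measurable_set1 (0 : R)); rewrite setTI.
Qed.

Lemma hyperplane_rotation u v : dotv u u = dotv v v ->
  P [set w | dotv u (X w) = 0] = P [set w | dotv v (X w) = 0].
Proof.
move=> /reflection_exists[H HH Hv]; have [_ _ inv] := uX.
have := inv H HH _ (hyperplane_borel v) => <-.
by congr (P _); apply/seteqP; split => w /=; rewrite Hv.
Qed.

Lemma dotvZl c (u v : 'cV[R]_n) : dotv (c *: u) v = c * dotv u v.
Proof. by rewrite /dotv mulr_sumr; apply: eq_bigr => i _; rewrite mxE mulrA. Qed.

(** Rescaling [v] to the length of [u] does not change its hyperplane. *)
Lemma hyperplane_any u v : u != 0 -> v != 0 ->
  P [set w | dotv u (X w) = 0] = P [set w | dotv v (X w) = 0].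
Proof.
move=> u0 v0; have pu := dotv_gt0 u0; have pv := dotv_gt0 v0.
pose c := Num.sqrt (dotv u u / dotv v v).
have c0 : c != 0 by rewrite gt_eqF// sqrtr_gt0 divr_gt0.
rewrite (hyperplane_rotation (v := c *: v)); last first.
  rewrite dotvZl dotvC dotvZl mulrA -expr2 sqr_sqrtr ?divr_ge0// ?ltW//.
  by rewrite divfK// gt_eqF.
congr (P _); apply/seteqP; split => w /=; rewrite dotvZl.
  by move/eqP; rewrite mulf_eq0 (negbTE c0) => /eqP.
by move=> ->; rewrite mulr0.
Qed.

(** Points of the moment curve at natural parameters: infinitely many normals, any [n] of which are
    linearly independent (Vandermonde). *)
Definition moment_vector t : 'cV[R]_n := \col_i (t%:R ^+ i).

Lemma moment_vector_neq0 t : (0 < n)%N -> moment_vector t != 0.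
Proof.
move=> n0; apply/eqP => /matrixP/(_ (Ordinal n0) 0); rewrite !mxE expr0.
by move/eqP; rewrite oner_eq0.
Qed.

(* [t |-> dotv (moment_vector t) y] is a nonzero polynomial of degree < n. *)
Lemma moment_vector_orthogonal (y : 'cV[R]_n) N : y != 0 ->
  (count (fun t => dotv (moment_vector t) y == 0%R) (iota 0 N) <= n)%N.
Proof.
(* [insub] converts the natural index of the polynomial into an ordinal; its default 0 is never
   reached below [n]. *)
move=> y0; pose p := \poly_(i < n) (if insub i is Some j then y j 0 else 0 : R).
have py (j : 'I_n) : p`_j = y j 0 by rewrite coef_poly ltn_ord valK.
have p0 : p != 0.
  apply: contra_neq y0 => p0; apply/matrixP => i j.
  by rewrite ord1 -py p0 coef0 mxE.
have pE t : p.[t%:R] = dotv (moment_vector t) y.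
  rewrite (horner_coef_wide _ (size_poly _ _)); apply: eq_bigr => i _.
  by rewrite py !mxE mulrC.
pose rs := [seq (t%:R : R) | t <- iota 0 N & dotv (moment_vector t) y == 0].
rewrite -size_filter -(size_map (fun t : nat => t%:R : R)) ltnW//.
have sp : (size p <= n)%N by exact: size_poly.
apply: leq_trans sp; apply: max_poly_roots => //.
  apply/allP => z /mapP[t]; rewrite mem_filter => /andP[t0 _] ->.
  by rewrite /root pE.
rewrite map_inj_uniq ?filter_uniq ?iota_uniq// => a b /eqP.
by rewrite eqr_nat => /eqP.
Qed.

(** Double counting: the hyperplanes orthogonal to the moment vectors share one probability [p], and
    a nonzero point lies on at most [n] of them; integrating the number of hits gives [N p <= n] for
    all [N]. *)
Lemma hyperplane_null u : u != 0 -> P [set w | dotv u (X w) = 0] = 0%E.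
Proof.
move=> u0; have n0 : (0 < n)%N.
  case: (posnP n) => // n0; case/eqP: u0; apply/matrixP => i.
  by have := ltn_ord i; rewrite [X in (_ < X)%N]n0.
pose E := [set w | \sum_(i < n) (X w i 0) ^+ 2 = 1].
have PE : P E = 1%E by case: uX.
have mE : measurable E.
  rewrite -[X in measurable X]setTI.
  have ms : measurable_fun setT (fun w => \sum_(i < n) (X w i 0) ^+ 2).
    by apply: measurable_sum => i; apply: measurable_funX; exact: mX.
  exact: (ms measurableT _ (measurable_set1 1)).
pose A t := [set w | dotv (moment_vector t) (X w) = 0].
have mA t : measurable (A t) by exact: measurable_hyperplane.
(* Restricting to the sphere event [E] costs no mass and excludes [X w = 0], which lies on every
   hyperplane. *)
have PA t : P (A t `&` E) = P [set w | dotv u (X w) = 0].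
  rewrite -(hyperplane_any (moment_vector_neq0 t n0) u0) -/(A t).
  have PEc : P (~` E) = 0%E by rewrite probability_setC// PE subee.
  apply/eqP; rewrite eq_le; apply/andP; split.
    by apply: le_measure; rewrite ?inE//; exact: measurableI.
  have AU : A t `<=` (A t `&` E) `|` ~` E.
    by move=> w Aw; have [Ew|nEw] := pselect (E w); [left|right].
  have mAE : measurable (A t `&` E) by exact: measurableI.
  have mEc : measurable (~` E) by exact: measurableC.
  apply: (@le_trans _ _ (P ((A t `&` E) `|` ~` E))).
    by apply: le_measure; rewrite ?inE//; exact: measurableU.
  by apply: le_trans (measureU2 _ mAE mEc) _; rewrite [X in (_ + X)%E]PEc adde0.
pose p := fine (P [set w | dotv u (X w) = 0]).
have pE : P [set w | dotv u (X w) = 0] = p%:E.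
  by rewrite fineK// fin_num_measure//; exact: measurable_hyperplane.
have bound N : N%:R * p <= n%:R.
  have mt t : mean_is P (\1_(A t `&` E)) p.
    have mAE : measurable (A t `&` E) by exact: measurableI.
    split; first exact: integrable_indic.
    by rewrite integral_indic// setIT; exact: etrans (PA t) pE.
  have [iS eS] := mean_is_sum (iota 0 N) mt.
  have -> : N%:R * p = \sum_(t <- iota 0 N) p.
    by rewrite big_const_seq count_predT size_iota iter_addr_0 mulr_natl.
  rewrite -lee_fin -eS; have [iC eC] := mean_is_cst P (n%:R : R).
  rewrite -eC; apply: le_integral => // w _; rewrite lee_fin.
  have [wE|wE] := pselect (E w); last first.
    rewrite big1 ?ler0n// => t _; rewrite indicE memNset// => -[_]; exact: wE.
  have y0 : X w != 0.
    apply/eqP => X0; move: wE; rewrite /E /= big1.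
      by move/esym/eqP; rewrite oner_eq0.
    by move=> i _; rewrite X0 mxE expr0n.
  pose c := count (fun t => dotv (moment_vector t) (X w) == 0) (iota 0 N).
  apply: (@le_trans _ _ c%:R); last first.
    by rewrite ler_nat; exact: moment_vector_orthogonal.
  rewrite /c -sum1_count natr_sum [leRHS]big_mkcond/=; apply: ler_sum => t _.
  rewrite indicE; case: eqP => [_|h0]; first by rewrite ler_nat leq_b1.
  by rewrite memNset// => -[].
rewrite pE; congr (_%:E); apply/eqP; rewrite eq_le; apply/andP; split; last first.
  by rewrite -lee_fin -pE.
rewrite leNgt; apply/negP => p0.
(* An [N] exceeding [n / p], against [N p <= n]. *)
have := bound (Num.truncn (n%:R / p)).+1; apply/negP; rewrite -ltNge.
by rewrite -ltr_pdivrMr// truncnS_gt.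
Qed.
End Sphere.

(** Continuity away from 0, and the single point 0 treated apart. *)
Lemma measurable_invr {R : realType} : measurable_fun setT (@GRing.inv R).
Proof.
rewrite -(setvU [set (0 : R)]); apply/measurable_funU => //.
  exact: measurableC.
split; last exact: measurable_fun_set1.
apply: subspace_continuous_measurable_fun; first exact: measurableC.
apply: continuous_in_subspaceT => r; rewrite inE /= => /eqP r0.
exact: inv_continuous.
Qed.

(** By independence the joint law is a product measure, and each section of the diagonal is a single
    point, null for the law of [X]. *)
Lemma independent_atomless_neq {disp : measure_display} {S : measurableType disp}
    {R : realType} (P : probability S R) (X Y : S -> R) :
  measurable_fun setT X -> measurable_fun setT Y ->
  (forall A B, measurable A -> measurable B ->
    P (X @^-1` A `&` Y @^-1` B) = (P (X @^-1` A) * P (Y @^-1` B))%E) ->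
  (forall t, P (X @^-1` [set t]) = 0%E) ->
  P [set w | X w = Y w] = 0%E.
Proof.
move=> mX mY XY X0.
pose X' : {mfun S >-> R} := HB.pack X (isMeasurableFun.Build _ _ _ _ _ mX).
pose Y' : {mfun S >-> R} := HB.pack Y (isMeasurableFun.Build _ _ _ _ _ mY).
have mYX : measurable_fun setT (fun w => (Y w, X w)) by exact: measurable_fun_pair.
(* [Y] comes first so that the sections over the first coordinate are measured by the law of [X]. *)
pose YX : {mfun S >-> (R * R)%type} := HB.pack (fun w => (Y w, X w))
  (isMeasurableFun.Build _ _ _ _ _ mYX).
pose D := [set z : R * R | z.2 - z.1 = 0].
have mD : measurable D.
  have mf : measurable_fun setT (fun z : R * R => z.2 - z.1).
    by apply: measurable_funB; [exact: measurable_snd|exact: measurable_fst].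
  by rewrite -[D]setTI; exact: (mf measurableT _ (measurable_set1 0)).
have -> : [set w | X w = Y w] = YX @^-1` D.
  apply/seteqP; split => w; rewrite /D /=; first by move=> ->; rewrite subrr.
  by move/eqP; rewrite subr_eq0 => /eqP.
change (distribution P YX D = 0%E).
have prodE := @product_measure_unique _ _ _ _ R (distribution P Y') (distribution P X')
  (distribution P YX).
rewrite -(prodE _ D mD); last first.
  move=> A B mA mB; rewrite /distribution /pushforward muleC -XY// setIC.
  by congr (P _); apply/seteqP; split => w [].
rewrite /product_measure1 integral0_eq// => y _ /=.
have -> : xsection D y = [set y].
  apply/seteqP; split => z; rewrite /xsection /= inE /D /=.
    by move/eqP; rewrite subr_eq0 => /eqP.
  by move=> ->; rewrite subrr.
exact: X0.
Qed.

Section GenericPair.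
Context {disp : measure_display} {S : measurableType disp} {R : realType}.
Variables (P : probability S R) (n : nat) (X Y : S -> 'cV[R]_n).
Hypotheses (uX : uniform_on_sphere P X) (uY : uniform_on_sphere P Y)
  (XY : independent_vectors P X Y).

(* Off the hyperplanes where a denominator vanishes, the event says that the
   ratio [<u1, X> / <u2, X>], whose law has no atoms, equals a function of [Y]. *)
Lemma ratio_neq_null u1 u2 v1 v2 c : v1 != 0 -> u2 != 0 ->
  (forall t, u1 - t *: u2 != 0) ->
  P.-negligible [set w | dotv u1 (X w) * dotv v1 (Y w) =
                         c * (dotv u2 (X w) * dotv v2 (Y w))].
Proof.
move=> v10 u20 u12.
have neg (Z : S -> 'cV[R]_n) u : uniform_on_sphere P Z -> u != 0 ->
    P.-negligible [set w | dotv u (Z w) = 0].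
  move=> uZ u0; apply/negligibleP; first exact: (measurable_hyperplane uZ u).
  exact: hyperplane_null.
pose f (y : 'cV[R]_n) := dotv u1 y / dotv u2 y.
pose g (y : 'cV[R]_n) := c * (dotv v2 y / dotv v1 y).
have mquot (u v : 'cV[R]_n) : measurable_fun setT (fun y : mxB R n 1 => dotv u y / dotv v y).
  apply: measurable_funM; first exact: measurable_dotv.
  exact: (measurableT_comp measurable_invr (measurable_dotv v)).
have mf : measurable_fun setT (f : mxB R n 1 -> R) by exact: mquot.
have mg : measurable_fun setT (g : mxB R n 1 -> R).
  by apply: measurable_funM; [exact: measurable_cst|exact: mquot].
have mX : random_mx X by case: uX.
have mY : random_mx Y by case: uY.
have mfX : measurable_fun setT (f \o X).
  exact: (measurableT_comp mf (measurable_random_mx mX)).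
have mgY : measurable_fun setT (g \o Y).
  exact: (measurableT_comp mg (measurable_random_mx mY)).
have borel (k : mxB R n 1 -> R) B : measurable_fun setT k -> measurable B ->
    mx_borel (k @^-1` B).
  by move=> mk mB; have := mk measurableT _ mB; rewrite setTI.
have fgneg : P.-negligible [set w | f (X w) = g (Y w)].
  apply/negligibleP.
    have mfg : measurable_fun setT (fun w => f (X w) - g (Y w)).
      exact: measurable_funB.
    have -> : [set w | f (X w) = g (Y w)] = (fun w => f (X w) - g (Y w)) @^-1` [set 0].
      apply/seteqP; split => w /=; first by move=> ->; rewrite subrr.
      by move/eqP; rewrite subr_eq0 => /eqP.
    by rewrite -[X in measurable X]setTI; exact: (mfg measurableT _ (measurable_set1 0)).
  apply: (independent_atomless_neq mfX mgY).
    by move=> A B mA mB; exact: (XY (borel _ _ mf mA) (borel _ _ mg mB)).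
  move=> t; have mft : measurable ((f \o X) @^-1` [set t]).
    by rewrite -[X in measurable X]setTI; exact: (mfX measurableT _ (measurable_set1 t)).
  apply/(negligibleP _ mft).
  (* Where [<u2, X>] is nonzero, [f X = t] says that [X] is orthogonal to [u1 - t u2]: the atom lies
     in two null hyperplanes. *)
  apply: (negligibleS _ (negligibleU (neg X _ uX u20) (neg X _ uX (u12 t)))).
  move=> w /= ft; have [u2X|u2X] := eqVneq (dotv u2 (X w)) 0; [by left|right].
  rewrite /= dotvC dotvBr dotvC [dotv _ (t *: _)]dotvC dotvZl -ft /f divfK//.
  by rewrite subrr.
apply: (negligibleS _ (negligibleU fgneg (negligibleU (neg X _ uX u20) (neg Y _ uY v10)))).
move=> w /= e; have [u2X|u2X] := eqVneq (dotv u2 (X w)) 0; [by right; left|].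
have [v1Y|v1Y] := eqVneq (dotv v1 (Y w)) 0; [by right; right|left].
apply: (mulIf u2X); apply: (mulIf v1Y); rewrite /f /g divfK// e.
by field; rewrite ?u2X ?v1Y.
Qed.
End GenericPair.

(** * Recovery *)

Section Recovery.
Context {disp : measure_display} {T : measurableType disp} {R : realType}.
Variables (P : probability T R) (k d : nat) (I : eqType).
Variables (O : 'M[R]_(d, k)) (h : T -> 'cV[R]_k) (x : I -> T -> 'cV[R]_d).
Variables (v1 v2 v3 v4 : I) (v_uniq : uniq [:: v1; v2; v3; v4]).
Hypotheses (model : factor_model P O h x)
  (moments : finite_moments P h (x v1) (x v2) (x v3) (x v4)).
Variables (U : 'M[R]_(d, k)) (V : 'M[R]_k).
Hypothesis UV : eca_choice (pairs P (x v1) (x v2)) U V.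

Let N := canonO P O h.
Let M := (U *m V)^T *m N.

Let iPairs := finite_pairs moments.

Let v12 : v1 != v2.
Proof. by move: v_uniq; rewrite /= !inE => /andP[]; case: (v1 == v2). Qed.

Let UV' : eca_choice (N *m N^T) U V.
Proof. by rewrite -(pairsE model (finite_factor_mean moments)
  (finite_factor_variance moments) (finite_factor_fourth moments) v12 iPairs). Qed.

Lemma whitened_cols i j : dotv (col i M) (col j M) = (i == j)%:R.
Proof.
have := mulmx1C (whitened_orthogonal UV') => /matrixP/(_ i j).
rewrite [RHS]mxE => <-; rewrite [RHS]mxE; apply: eq_bigr => a _.
by rewrite [M^T i a]mxE [col i M _ _]mxE [col j M _ _]mxE.
Qed.

Definition spectrum (th th' : 'cV[R]_k) : 'rV[R]_k :=
  \row_i (excess_kurtosis P (component h i) *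
    (dotv (col i M) th * dotv (col i M) th')).

(** [<W th, N_i> = <th, M_i>], because [M = W^T N]. *)
Lemma whitened_quadruples th th' :
  (U *m V)^T *m quadruples P (x v1) (x v2) (x v3) (x v4)
     ((U *m V) *m th) ((U *m V) *m th') *m (U *m V)
  = M *m diag_mx (spectrum th th') *m M^T.
Proof.
rewrite (quadruplesE model (finite_factor_mean moments)
  (finite_factor_variance moments) (finite_factor_fourth moments) v_uniq iPairs
  (finite_quadruples moments _ _)).
rewrite -/N [M^T]trmx_mul trmxK /M !mulmxA; congr (_ *m diag_mx _ *m _ *m _ *m _).
apply/rowP => i; rewrite !mxE -mulrA; congr (_ * (_ * _)).
  by rewrite dotvC !dotvE !tr_col trmx_mul trmxK -row_mul !mulmxA row_mul.
by rewrite dotvC !dotvE !tr_col trmx_mul trmxK -row_mul !mulmxA row_mul.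
Qed.

(** Serves both halves of the theorem; the signs depend on the singular value decomposition behind
    [Ohat]. *)
Lemma eca_output_columns th th' Ohat :
  eca_output (quadruples P (x v1) (x v2) (x v3) (x v4)) U V th th' Ohat ->
  exists sg : 'I_k -> bool, Ohat `<=` canonical_columns P O h sg /\
   ((forall i j, spectrum th th' 0 i ^+ 2 = spectrum th th' 0 j ^+ 2 -> i = j) ->
    Ohat = canonical_columns P O h sg).
Proof.
move=> [Q [s [Z [svd ->]]]]; rewrite whitened_quadruples in svd.
have MM := whitened_orthogonal UV'.
exists (column_sign M Q s).
have cc : canonical_columns P O h (column_sign M Q s) =
    [set (Defs.pinv (U *m V))^T *m l |
       l in range (fun i => (-1) ^+ column_sign M Q s i *: col i M)].
  rewrite image_comp; apply: eq_imagel => i _ /=.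
  rewrite -scalemxAr [col i M]colE mulmxA (pinv_whitened UV') -colE -scalerA; congr (_ *: _).
  by apply/matrixP => a b; rewrite !mxE mulrC.
rewrite cc; split; first exact/image_subset/(simple_vectors_sub MM svd).
by move=> sp; rewrite (simple_vectors_eq MM svd sp).
Qed.

Hypothesis kurt : forall i, excess_kurtosis P (component h i) != 0.
Context {disp' : measure_display} {S : measurableType disp'}.
Variables (Pr : probability S R) (theta theta' : S -> 'cV[R]_k).
Hypotheses (uth : uniform_on_sphere Pr theta) (uth' : uniform_on_sphere Pr theta')
  (ind : independent_vectors Pr theta theta').

Lemma whitened_col_neq0 i : col i M != 0.
Proof.
apply/eqP => Mi; have := whitened_cols i i.
by rewrite Mi dotvE mulmx0 mxE eqxx => /esym/eqP; rewrite oner_eq0.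
Qed.

(** Equal squares mean equal or opposite values; after division by the kurtosis of [i] these are two
    instances of [ratio_neq_null], with [c] plus or minus the ratio of kurtoses. The pairs [(i, j)]
    are finitely many. *)
Lemma spectrum_distinct : {ae Pr, forall w, forall i j,
  spectrum (theta w) (theta' w) 0 i ^+ 2 = spectrum (theta w) (theta' w) 0 j ^+ 2 ->
  i = j}.
Proof.
apply: filter_forall => i; apply: filter_forall => j.
have [->|ij] := eqVneq i j; first exact: aeW.
(* Orthonormality: pairing with column [i] would give [1 = 0]. *)
have Mij t : col i M - t *: col j M != 0.
  apply/eqP => e; have := congr1 (dotv (col i M)) e.
  rewrite dotvBr (dotvC _ (t *: _)) dotvZl !whitened_cols eqxx eq_sym (negbTE ij).
  by rewrite mulr0 subr0 dotvE mulmx0 mxE => /eqP; rewrite oner_eq0.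
pose c := excess_kurtosis P (component h j) / excess_kurtosis P (component h i).
have neg e := ratio_neq_null uth uth' ind (col j M) e
  (whitened_col_neq0 i) (whitened_col_neq0 j) Mij.
apply: (negligibleS _ (negligibleU (neg c) (neg (- c)))).
move=> w /= /not_implyP[+ _] => /eqP; rewrite eqf_sqr !mxE => /orP[]/eqP e; [left|right].
  by apply: (mulfI (kurt i)); rewrite e /c; field; exact: kurt.
by apply: (mulfI (kurt i)); rewrite e /c; field; exact: kurt.
Qed.
End Recovery.

Theorem theorem4p2 (R : realType) (disp : measure_display)
  (T : measurableType disp) (P : probability T R) (k d : nat) (I : eqType)
  (O : 'M[R]_(d, k)) (h : T -> 'cV[R]_k) (x : I -> T -> 'cV[R]_d)
  (v1 v2 v3 v4 : I) (v_uniq : uniq [:: v1; v2; v3; v4])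
  (model : factor_model P O h x)
  (moments : finite_moments P h (x v1) (x v2) (x v3) (x v4)) :
  let Pairs := pairs P (x v1) (x v2) in
  let Quadruples := quadruples P (x v1) (x v2) (x v3) (x v4) in
  (forall (theta theta' : 'cV[R]_k) (U : 'M[R]_(d, k)) (V : 'M[R]_k)
          (Ohat : set 'cV[R]_d),
     eca_choice Pairs U V ->
     eca_output Quadruples U V theta theta' Ohat ->
     exists sg : 'I_k -> bool, Ohat `<=` canonical_columns P O h sg)
  /\
  ((forall i, excess_kurtosis P (component h i) != 0) ->
   forall (disp' : measure_display) (S : measurableType disp')
     (Pr : probability S R) (theta theta' : S -> 'cV[R]_k),
   uniform_on_sphere Pr theta ->
   uniform_on_sphere Pr theta' ->
   independent_vectors Pr theta theta' ->
   forall (U : 'M[R]_(d, k)) (V : 'M[R]_k), eca_choice Pairs U V ->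
   {ae Pr, forall w, forall Ohat : set 'cV[R]_d,
      eca_output Quadruples U V (theta w) (theta' w) Ohat ->
      exists sg : 'I_k -> bool, Ohat = canonical_columns P O h sg}).
Proof.
move=> Pairs Quadruples; split.
  move=> theta theta' U V Ohat UV out.
  have [sg [sub _]] := eca_output_columns v_uniq model moments UV out.
  by exists sg.
move=> kurt disp' S Pr theta theta' uth uth' ind U V UV.
(* The exceptional null set is fixed before any singular value decomposition is chosen, so it serves
   all outputs [Ohat] at once. *)
apply: filterS (spectrum_distinct v_uniq model moments UV kurt uth uth' ind).
move=> w distinct Ohat out.
have [sg [_ eqO]] := eca_output_columns v_uniq model moments UV out.
by exists sg; exact: eqO.
Qed.
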